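(* There exist universal constants $c_0,c_1,C,\tilde C,\tilde D>0$, with $c_0$ a positive integer (none depending on $m,n,r,d,\delta,L,f,K$), such that the following holds. Let $1\le r\le m\le n$ be integers, $\delta\in(0,1)$, and let $f:\mathbb{R}^{m\times n}\to\mathbb{R}$ be differentiable, bounded below by $f_{\mathrm{low}}\in\mathbb{R}$, $L$-smooth with respect to the Frobenius norm ($L>0$), with $(\delta,r)$-approximately-low-rank gradients. Put $C_{\mathrm{IHT}}(m,r)=8C\frac{m}{r}+5$ and suppose $C_{\mathrm{IHT}}(m,r)<\delta^{-2}$. Let $d=2c_0r(m+n)$, and let $Z_1,\dots,Z_d\in\mathbb{R}^{m\times n}$ be random matrices, drawn once, all of whose entries are independent $\mathcal{N}(0,1/d)$ variables. Fix $X_0\in\mathbb{R}^{m\times n}$ and, for $k=0,\dots,K-1$ with $K\ge 1$, iterate $$X_{k+1}=X_k-\tfrac1L G_k,$$ where $G_k$ is the output of iterative hard thresholding applied to $(\mathcal{Z},\vec y_k)$, $\vec y_k=\mathcal{Z}(\nabla f(X_k))$, started at $0$ with step size $1/(1+\delta_{2r}(\mathcal{Z}))$, and run for $t_k$ inner iterations, where $$t_k\ \ge\ \tilde D\log\!\left(\frac{\|\vec y_k\|^2}{(\tilde C\frac mr+2)\delta^2\|\nabla f(X_k)\|^2}\right)$$ (no condition if $\nabla f(X_k)=0$ or $\vec y_k=0$). Then, with probability at least $1-e^{-c_1d}$, $$\min_{0\le k\le K-1}\|\nabla f(X_k)\|^2\ \le\ \frac{2L\,(f(X_0)-f_{\m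athrm{low}})}{\left(1-\delta^2C_{\mathrm{IHT}}(m,r)\right)K}.$$
   Context: Norms on $\mathbb{R}^{m\times n}$ written $\|\cdot\|$ are Frobenius norms, coming from $\langle A,B\rangle=\mathrm{trace}(A^\top B)$; on vectors $\|\cdot\|$ is the Euclidean norm. Bounded below by $f_{\mathrm{low}}$: $f(X)\ge f_{\mathrm{low}}$ for all $X$. $L$-smooth: $\|\nabla f(X)-\nabla f(Y)\|\le L\|X-Y\|$ for all $X,Y$. $\mathrm{Proj}_r(A)$ denotes a nearest matrix of rank at most $r$ to $A$ in Frobenius norm (obtained from the SVD of $A$ by keeping the $r$ largest singular values). $A$ is $(\delta,r)$-approximately-low-rank if $\|A-\mathrm{Proj}_r(A)\|\le\delta\|A\|$; $f$ has $(\delta,r)$-approximately-low-rank gradients if $\nabla f(X)$ is $(\delta,r)$-approximately-low-rank for every $X$. Sensing operator: $\mathcal{Z}:\mathbb{R}^{m\times n}\to\mathbb{R}^d$, $[\mathcal{Z}(A)]_i=\langle Z_i,A\rangle$, with adjoint $\mathcal{Z}^*(\vec y)=\sum_i y_iZ_i$. Restricted isometry: $\delta_s(\mathcal{Z})$ is the smallest $\delta'\in(0,1)$ such that $(1-\delta')\|G\|^2\le\|\mathcal{Z}(G)\|^2\le(1+\delta')\|G\|^2$ for all $G$ of rank at most $s$ (when such a $\delta'$ exists). Iterative hard thresholding (IHT) with step size $\eta$ applied to $(\mathcal{Z},\vec y)$: $G^{t+1}=\mathrm{Proj}_r\big(G^t-\eta\,\mathcal{Z}^*(\mathcal{Z}(G^t)-\vec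 y)\big)$. *)

(* Defs.v *)
From HB Require Import structures.
From mathcomp Require Export all_boot all_order all_algebra.
From mathcomp Require Export all_classical all_reals all_analysis.
Export Order.TTheory GRing.Theory Num.Theory numFieldNormedType.Exports.

Set Implicit Arguments.
Unset Strict Implicit.
Unset Printing Implicit Defensive.

Local Open Scope classical_set_scope.
Local Open Scope ring_scope.

Section Frobenius.
Context {R : realType} {m n : nat}.
Implicit Types (A B G X : 'M[R]_(m, n)) (f : 'M[R]_(m, n) -> R).

Definition frob_dot A B : R := \tr (A^T *m B).

(* On column vectors this is the Euclidean norm.  The norm [`|A|] of the
   library is the maximum norm; it is only used through the (equivalent)
   topology, in [differentiable] and ['D_v]. *)
Definition frob_norm A : R := Num.sqrt (frob_dot A A).

Definition grad f X : 'M[R]_(m, n) :=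
  \matrix_(i, j) 'D_(delta_mx i j : 'M[R]_(m, n)) f X.

Definition smooth (L : R) f : Prop :=
  forall X Y, frob_norm (grad f X - grad f Y) <= L * frob_norm (X - Y).

(* [Proj_r(A)] need not be unique, hence a relation rather than a function. *)
Definition is_proj (r : nat) A B : Prop :=
  (\rank B <= r)%N /\
  forall B', (\rank B' <= r)%N -> frob_norm (A - B) <= frob_norm (A - B').

(* All nearest matrices are at the same distance from [A], so it does not matter
   which of them is taken. *)
Definition approx_low_rank (delta : R) (r : nat) A : Prop :=
  exists2 B, is_proj r A B & frob_norm (A - B) <= delta * frob_norm A.

Lemma frob_dotE A B : frob_dot A B = \sum_i \sum_j A i j * B i j.
Proof.
rewrite /frob_dot /mxtrace exchange_big; apply: eq_bigr => j _.
by rewrite mxE; apply: eq_bigr => i _; rewrite mxE.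
Qed.

Lemma frob_dot_grad f X A : differentiable f X ->
  frob_dot (grad f X) A = 'd f X A.
Proof.
move=> df; rewrite frob_dotE [in RHS](matrix_sum_delta A) linear_sum.
apply: eq_bigr => i _; rewrite linear_sum; apply: eq_bigr => j _.
by rewrite linearZ mxE deriveE// mulrC.
Qed.

End Frobenius.

Section Sensing.
Context {R : realType} {m n d : nat}.
Implicit Types (Z : 'I_d -> 'M[R]_(m, n)) (y : 'cV[R]_d) (A G : 'M[R]_(m, n)).

Definition sense Z A : 'cV[R]_d := \col_i frob_dot (Z i) A.

Definition sense_adj Z y : 'M[R]_(m, n) := \sum_(i < d) y i 0 *: Z i.

Definition rip_bounds Z (s : nat) : set R :=
  [set delta | 0 < delta < 1 /\
     forall G, (\rank G <= s)%N ->
       (1 - delta) * frob_norm G ^+ 2 <= frob_norm (sense Z G) ^+ 2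
         <= (1 + delta) * frob_norm G ^+ 2].

(* Only meaningful when [rip_bounds Z s !=set0].  The infimum is then attained
   (see [rip_const_min]), unless [Z] is an exact isometry on matrices of rank at
   most [s], in which case it is 0. *)
Definition rip_const Z (s : nat) : R := inf (rip_bounds Z s).

Lemma rip_const_min Z (s : nat) :
  rip_bounds Z s !=set0 -> 0 < rip_const Z s ->
  rip_bounds Z s (rip_const Z s) /\ lbound (rip_bounds Z s) (rip_const Z s).
Proof.
move=> ne c_gt0.
have hlb : has_lbound (rip_bounds Z s) by exists 0 => x [/andP[/ltW]].
have lb : lbound (rip_bounds Z s) (rip_const Z s) by exact: ge_inf.
split=> //; split.
  rewrite c_gt0 /=; case: ne => x xZ.
  by apply: le_lt_trans (lb _ xZ) _; case: xZ => /andP[].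
move=> G rG; set N := frob_norm G ^+ 2; set S := frob_norm _ ^+ 2.
have N0 : 0 <= N by exact: sqr_ge0.
have near e : 0 < e -> exists2 x, x < rip_const Z s + e &
    (1 - x) * N <= S <= (1 + x) * N.
  move=> e0; have [x [_ /(_ G rG) xG] xe] := inf_adherent e0 (conj ne hlb).
  by exists x.
apply/andP; split; apply/ler_addgt0Pr => e e0.
  have e'0 : 0 < e / (N + 1) by rewrite divr_gt0// ltr_wpDl.
  have [x xlt /andP[xS _]] := near _ e'0.
  apply: (@le_trans _ _ ((1 - x) * N + e / (N + 1) * N)).
    rewrite -mulrDl ler_wpM2r// -addrA lerD2l lerNl opprD opprK lerBlDr.
    exact: ltW.
  rewrite lerD// mulrAC ler_pdivrMr ?ltr_wpDl// ler_wpM2l ?(ltW e0)//.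
  by rewrite lerDl.
have e'0 : 0 < e / (N + 1) by rewrite divr_gt0// ltr_wpDl.
have [x xlt /andP[_ xS]] := near _ e'0.
apply: (le_trans xS).
apply: (@le_trans _ _ ((1 + rip_const Z s) * N + e / (N + 1) * N)).
  by rewrite -mulrDl ler_wpM2r// -addrA lerD2l ltW.
rewrite lerD2l mulrAC ler_pdivrMr ?ltr_wpDl// ler_wpM2l ?(ltW e0)//.
by rewrite lerDl.
Qed.

(* [G] is a possible output of [t] iterations started at 0, each projection
   being an arbitrary choice of nearest matrix. *)
Definition iht_output Z y (r : nat) (eta : R) (t : nat) G : Prop :=
  exists H : nat -> 'M[R]_(m, n),
    [/\ H 0%N = 0,
        forall s, (s < t)%N ->
          is_proj r (H s - eta *: sense_adj Z (sense Z (H s) - y)) (H s.+1)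
      & H t = G].

End Sensing.

Section Probability.
Context {R : realType} {dT : measure_display} {T : measurableType dT}.

Definition mutually_independent (P : probability T R) (I : finType)
    (X : I -> {RV P >-> R}) : Prop :=
  forall (J : {set I}) (B : I -> set R), (forall i, measurable (B i)) ->
    P (\bigcap_(i in [set` J]) (X i @^-1` B i)) =
    (\prod_(i in J) P (X i @^-1` B i))%E.

(* The second parameter of [normal_prob] is the standard deviation. *)
Definition normal_rv (P : probability T R) (mu var : R)
    (X : {RV P >-> R}) : Prop :=
  forall B : set R, measurable B ->
    distribution P X B = normal_prob mu (Num.sqrt var) B.

Definition iid_gaussian_entries (P : probability T R) (m n d : nat)
    (Z : 'I_d -> 'I_m -> 'I_n -> {RV P >-> R}) : Prop :=
  mutually_independent
    (fun a : 'I_d * 'I_m * 'I_n => Z a.1.1 a.1.2 a.2) /\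
  forall i a b, normal_rv 0 d%:R^-1 (Z i a b).

Definition random_sensing (P : probability T R) (m n d : nat)
    (Z : 'I_d -> 'I_m -> 'I_n -> {RV P >-> R}) (w : T) : 'I_d -> 'M[R]_(m, n) :=
  fun i => \matrix_(a, b) Z i a b w.

End Probability.

Section Descent.
Context {R : realType} {m n d : nat}.

(* [log] carries no condition when its argument would be 0 or 0/0.  When the
   logarithm is negative the condition is vacuous, as [t] is a natural number. *)
Definition inner_iterations_ok (Ct Dt delta : R) (r : nat)
    (g : 'M[R]_(m, n)) (y : 'cV[R]_d) (t : nat) : Prop :=
  g != 0 -> y != 0 ->
  Dt * ln (frob_norm y ^+ 2 /
           ((Ct * (m%:R / r%:R) + 2) * delta ^+ 2 * frob_norm g ^+ 2))
    <= t%:R.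

Definition iht_descent (f : 'M[R]_(m, n) -> R) (L delta Ct Dt : R) (r K : nat)
    (X0 : 'M[R]_(m, n)) (Z : 'I_d -> 'M[R]_(m, n))
    (X : nat -> 'M[R]_(m, n)) : Prop :=
  X 0%N = X0 /\
  forall k, (k < K)%N ->
    let g := grad f (X k) in
    let y := sense Z g in
    exists (t : nat) (G : 'M[R]_(m, n)),
      [/\ inner_iterations_ok Ct Dt delta r g y t,
          iht_output Z y r (1 + rip_const Z (2 * r))^-1 t G
        & X k.+1 = X k - L^-1 *: G].

End Descent.

Definition C_IHT {R : realType} (C : R) (m r : nat) : R := 8 * C * (m%:R / r%:R) + 5.

(* Main.v *)
(* Two ingredients.

   (1) Restricted isometry.  For a fixed matrix G of norm 1, the entries of
   Z(G) are independent centred Gaussians of variance 1/d, and the two tails of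
   |Z(G)|^2 are exponentially small in d.  Independence is used only through
   E exp(sum_i t_i <Z_i, G>) = prod_i E exp(t_i <Z_i, G>).  For the upper tail,
   exp(l s^2) is itself a Gaussian average of the functions exp(t s); for the
   lower tail, exp(- x^2 / 2) <= 1 / cosh x <= 1 - u + u^2 with
   u = cosh x - 1, which is a finite combination of functions exp(t x).  A
   matrix of rank at most k and norm 1 is U W with U a partial isometry and
   |W| = 1, so nets for U (in operator norm) and W give a net of size
   exp(O(k (m + n))) for such matrices.

   (2) Optimization.  With restricted isometry constant at most 1/9 for rank
   2 r, one thresholding step satisfies Phi' <= Phi / 2 + 3/2 Phi*, where Phi is
   the squared residual and Phi* the residual of the best rank-r approximation
   of the gradient.  The tail of the gradient has rank up to m, but splits into
   at most 2 m / r blocks of r rows, so Phi* <= C (m / r) delta^2 |grad f|^2.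
   Hence |G - grad f|^2 <= delta^2 C_IHT |grad f|^2, and the descent lemma
   f(X - G / L) <= f(X) - |grad f|^2 / (2 L) + |grad f - G|^2 / (2 L)
   telescopes. *)
From mathcomp Require Import ring lra zify.
From mathcomp Require Import measurable_realfun.
Require Import Defs.

Set Implicit Arguments.
Unset Strict Implicit.
Unset Printing Implicit Defensive.

Local Open Scope classical_set_scope.
Local Open Scope ring_scope.

(** * The Frobenius inner product *)

Section FrobeniusTheory.
Context {R : realType}.

Lemma frob_dotC m n (A B : 'M[R]_(m, n)) : frob_dot A B = frob_dot B A.
Proof.
by rewrite !frob_dotE; do 2![apply: eq_bigr => ? _]; rewrite mulrC.
Qed.

Lemma frob_dotDr m n (A B C : 'M[R]_(m, n)) :
  frob_dot A (B + C) = frob_dot A B + frob_dot A C.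
Proof. by rewrite /frob_dot mulmxDr mxtraceD. Qed.

Lemma frob_dotZr m n a (A B : 'M[R]_(m, n)) :
  frob_dot A (a *: B) = a * frob_dot A B.
Proof. by rewrite /frob_dot -scalemxAr mxtraceZ. Qed.

Lemma frob_dotNr m n (A B : 'M[R]_(m, n)) : frob_dot A (- B) = - frob_dot A B.
Proof. by rewrite -scaleN1r frob_dotZr mulN1r. Qed.

Lemma frob_dot0r m n (A : 'M[R]_(m, n)) : frob_dot A 0 = 0.
Proof. by rewrite -(scale0r 0) frob_dotZr mul0r. Qed.

Lemma frob_dotDl m n (A B C : 'M[R]_(m, n)) :
  frob_dot (A + B) C = frob_dot A C + frob_dot B C.
Proof. by rewrite frob_dotC frob_dotDr !(frob_dotC C). Qed.

Lemma frob_dotZl m n a (A B : 'M[R]_(m, n)) :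
  frob_dot (a *: A) B = a * frob_dot A B.
Proof. by rewrite frob_dotC frob_dotZr frob_dotC. Qed.

Lemma frob_dotNl m n (A B : 'M[R]_(m, n)) : frob_dot (- A) B = - frob_dot A B.
Proof. by rewrite frob_dotC frob_dotNr frob_dotC. Qed.

Lemma frob_dot_mull m n p (U : 'M[R]_(m, p)) (A : 'M[R]_(p, n)) B :
  frob_dot (U *m A) B = frob_dot A (U^T *m B).
Proof. by rewrite /frob_dot trmx_mul mulmxA. Qed.

Lemma frob_dot_ge0 m n (A : 'M[R]_(m, n)) : 0 <= frob_dot A A.
Proof.
rewrite frob_dotE; apply: sumr_ge0 => i _; apply: sumr_ge0 => j _.
by rewrite -expr2 sqr_ge0.
Qed.

Lemma frob_norm_ge0 m n (A : 'M[R]_(m, n)) : 0 <= frob_norm A.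
Proof. exact: sqrtr_ge0. Qed.

Lemma sqr_frob_norm m n (A : 'M[R]_(m, n)) : frob_norm A ^+ 2 = frob_dot A A.
Proof. by rewrite sqr_sqrtr ?frob_dot_ge0. Qed.

Lemma frob_norm0 m n : frob_norm (0 : 'M[R]_(m, n)) = 0.
Proof. by rewrite /frob_norm frob_dot0r sqrtr0. Qed.

Lemma coord_le_frob_norm m n (A : 'M[R]_(m, n)) i j : `|A i j| <= frob_norm A.
Proof.
rewrite -sqrtr_sqr ler_wsqrtr// frob_dotE (bigD1 i)//= (bigD1 j)//= -expr2.
rewrite -addrA lerDl addr_ge0// ?sumr_ge0// => k _;
  rewrite ?sumr_ge0// -?expr2 ?sqr_ge0//.
by move=> l _; rewrite -expr2 sqr_ge0.
Qed.

Lemma frob_norm_eq0 m n (A : 'M[R]_(m, n)) : (frob_norm A == 0) = (A == 0).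
Proof.
apply/eqP/eqP => [A0|->]; last exact: frob_norm0.
apply/matrixP => i j; apply/eqP; rewrite mxE -normr_eq0 eq_le normr_ge0 andbT.
by rewrite -A0 coord_le_frob_norm.
Qed.

Lemma frob_norm_gt0 m n (A : 'M[R]_(m, n)) : (0 < frob_norm A) = (A != 0).
Proof. by rewrite lt_neqAle eq_sym frob_norm_eq0 frob_norm_ge0 andbT. Qed.

Lemma frob_normZ m n a (A : 'M[R]_(m, n)) :
  frob_norm (a *: A) = `|a| * frob_norm A.
Proof.
by rewrite /frob_norm frob_dotZl frob_dotZr mulrA -expr2 sqrtrM ?sqr_ge0// sqrtr_sqr.
Qed.

Lemma frob_normN m n (A : 'M[R]_(m, n)) : frob_norm (- A) = frob_norm A.
Proof. by rewrite -scaleN1r frob_normZ normrN1 mul1r. Qed.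

Lemma frob_norm_distC m n (A B : 'M[R]_(m, n)) :
  frob_norm (A - B) = frob_norm (B - A).
Proof. by rewrite -frob_normN opprB. Qed.

Lemma frob_normD_sqr m n (A B : 'M[R]_(m, n)) :
  frob_norm (A + B) ^+ 2 =
  frob_norm A ^+ 2 + 2 * frob_dot A B + frob_norm B ^+ 2.
Proof.
rewrite !sqr_frob_norm frob_dotDl !frob_dotDr (frob_dotC B A).
by ring.
Qed.

Lemma frob_normB_sqr m n (A B : 'M[R]_(m, n)) :
  frob_norm (A - B) ^+ 2 =
  frob_norm A ^+ 2 - 2 * frob_dot A B + frob_norm B ^+ 2.
Proof. by rewrite frob_normD_sqr frob_normN frob_dotNr mulrN. Qed.

Lemma frob_normB_sqr_le m n (A B : 'M[R]_(m, n)) :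
  frob_norm (A - B) ^+ 2 <= 2 * frob_norm A ^+ 2 + 2 * frob_norm B ^+ 2.
Proof.
have := sqr_ge0 (frob_norm (A + B)).
rewrite frob_normB_sqr frob_normD_sqr; lra.
Qed.

Lemma frob_dot_le m n (A B : 'M[R]_(m, n)) :
  frob_dot A B <= frob_norm A * frob_norm B.
Proof.
have [/eqP|B0] := boolP (B == 0).
  by move=> ->; rewrite frob_dot0r frob_norm0 mulr0.
have [/eqP|A0] := boolP (A == 0).
  by move=> ->; rewrite frob_dotC frob_dot0r frob_norm0 mul0r.
have a0 : 0 < frob_norm A by rewrite frob_norm_gt0.
have b0 : 0 < frob_norm B by rewrite frob_norm_gt0.
have := sqr_ge0 (frob_norm (frob_norm B *: A - frob_norm A *: B)).
rewrite frob_normB_sqr !frob_normZ frob_dotZl frob_dotZr !gtr0_norm//.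
set a := frob_norm A in a0 *; set b := frob_norm B in b0 *; set c := frob_dot A B.
move=> h; have ab : 0 < a * b by rewrite mulr_gt0.
rewrite -(ler_pM2l ab); nra.
Qed.

Lemma frob_dot_abs_le m n (A B : 'M[R]_(m, n)) :
  `|frob_dot A B| <= frob_norm A * frob_norm B.
Proof.
rewrite ler_norml frob_dot_le andbT lerNl -frob_dotNl -(frob_normN A).
exact: frob_dot_le.
Qed.

Lemma frob_normD m n (A B : 'M[R]_(m, n)) :
  frob_norm (A + B) <= frob_norm A + frob_norm B.
Proof.
rewrite -ler_sqr ?nnegrE ?addr_ge0 ?frob_norm_ge0// frob_normD_sqr sqrrD.
by rewrite lerD2r lerD2l -[leRHS]mulr_natl ler_wpM2l// frob_dot_le.
Qed.

Lemma frob_normB m n (A B : 'M[R]_(m, n)) :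
  frob_norm (A - B) <= frob_norm A + frob_norm B.
Proof. by rewrite -(frob_normN B) frob_normD. Qed.

Lemma frob_norm_sum m n (I : finType) (F : I -> 'M[R]_(m, n)) :
  frob_norm (\sum_i F i) <= \sum_i frob_norm (F i).
Proof.
elim/big_ind2 : _ => [|A a B b hA hB|//]; first by rewrite frob_norm0.
by rewrite (le_trans (frob_normD _ _))// lerD.
Qed.

Lemma frob_norm_sum_sqr m n q (F : 'I_q -> 'M[R]_(m, n)) :
  frob_norm (\sum_i F i) ^+ 2 <= q%:R * \sum_i frob_norm (F i) ^+ 2.
Proof.
have [q0|q0] := posnP q.
  by subst q; rewrite !big_ord0 frob_norm0 expr0n mul0r.
set S := \sum_i F i; set T := \sum_i _.
have qR : 0 < q%:R :> R by rewrite ltr0n.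
have -> : frob_norm S ^+ 2 = \sum_i frob_dot (F i) S.
  rewrite sqr_frob_norm {1}/S; elim/big_ind2 : _ => //.
    by rewrite frob_dotC frob_dot0r.
  by move=> A a B b; rewrite frob_dotDl => -> ->.
have S2 : \sum_i frob_dot (F i) S = frob_norm S ^+ 2.
  rewrite sqr_frob_norm {2}/S; elim/big_ind2 : _ => //.
    by rewrite frob_dotC frob_dot0r.
  by move=> a A b B -> ->; rewrite frob_dotDl.
(* Sum of squared deviations from the mean [S / q]; expanding it leaves exactly the Cauchy-Schwarz
   bound. *)
have : 0 <= \sum_i frob_norm (F i - q%:R^-1 *: S) ^+ 2.
  by apply: sumr_ge0 => i _; exact: sqr_ge0.
under eq_bigr do rewrite frob_normB_sqr frob_normZ frob_dotZr mulrCA.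
rewrite big_split sumrB /= -mulr_sumr -mulr_sumr -/T S2 sumr_const card_ord
  exprMn ger0_norm ?invr_ge0 ?ler0n//.
set x := frob_norm S ^+ 2.
have -> : q%:R^-1 ^+ 2 * x *+ q = q%:R^-1 * x.
  by rewrite -mulr_natl expr2 !mulrA divff ?gt_eqF// mul1r.
move=> h; rewrite -(ler_pM2l (_ : 0 < q%:R^-1)) ?invr_gt0//.
rewrite mulKf ?gt_eqF//; lra.
Qed.

(** The squared Frobenius norm is the sum of the squared column norms, and [U] acts on each column
    of [W] separately. *)
Lemma frob_norm_mul_op m n p (rho : R) (U : 'M[R]_(m, p)) (W : 'M[R]_(p, n)) :
  0 <= rho ->
  (forall x : 'cV_p, frob_norm (U *m x) <= rho * frob_norm x) ->
  frob_norm (U *m W) <= rho * frob_norm W.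
Proof.
move=> rho0 Urho.
have colsE q (A : 'M[R]_(q, n)) :
    frob_norm A ^+ 2 = \sum_j frob_norm (col j A) ^+ 2.
  rewrite sqr_frob_norm frob_dotE exchange_big; apply: eq_bigr => j _.
  rewrite sqr_frob_norm frob_dotE; apply: eq_bigr => i _.
  by rewrite big_ord1 !mxE.
rewrite -ler_sqr ?nnegrE ?mulr_ge0 ?frob_norm_ge0// exprMn !colsE mulr_sumr.
apply: ler_sum => j _; rewrite -exprMn ler_sqr ?nnegrE ?mulr_ge0 ?frob_norm_ge0//.
by rewrite colE -mulmxA -colE; exact: Urho.
Qed.

End FrobeniusTheory.

(** * Elementary inequalities *)

Section Calculus.
Context {R : realType}.
Implicit Types x y : R.

Lemma ge0_is_derive_le (f df : R -> R) a b :
  (forall x, is_derive x (1 : R) f (df x)) ->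
  (forall x, a < x -> x < b -> 0 <= df x) -> a <= b -> f a <= f b.
Proof.
move=> fdf df0 ab.
have dfx x : derivable f x 1 by have [] := fdf x.
apply: (@ger0_derive1_ndecr _ f a b) => //.
- move=> x; rewrite in_itv/= => /andP[ax xb].
  by rewrite derive1E (@derive_val _ _ _ _ _ _ _ (fdf x)) df0.
- apply: continuous_subspaceT => x.
  by apply: differentiable_continuous; exact/derivable1_diffP.
Qed.

Lemma mul_cosh_ge_sinh x : 0 <= x ->
  expR x - expR (- x) <= x * (expR x + expR (- x)).
Proof.
move=> x0; rewrite -subr_ge0.
pose g (y : R) := y * (expR y + expR (- y)) - (expR y - expR (- y)).
have -> : 0 = g 0 by rewrite /g oppr0 mul0r subrr subr0.
apply: (@ge0_is_derive_le g (fun y => y * (expR y - expR (- y)))) => //.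
  move=> y; apply: is_derive_eq; rewrite /= !scaler1 /GRing.scale/=; ring.
move=> y y0 _; rewrite mulr_ge0 ?(ltW y0)// subr_ge0 ler_expR.
by rewrite (@le_trans _ _ 0)// ?oppr_le0 ltW.
Qed.

(** For x >= 0, [h] vanishes at 0, and its derivative is nonnegative by [mul_cosh_ge_sinh]; evenness
    gives the rest. *)
Lemma cosh_le_expR_sqr x : (expR x + expR (- x)) / 2 <= expR (x ^+ 2 / 2).
Proof.
wlog x0 : x / 0 <= x => [H|].
  have [/H//|x0] := leP 0 x.
  by have := H (- x); rewrite opprK sqrrN addrC; apply; rewrite oppr_ge0 ltW.
rewrite ler_pdivrMr// -ler_pdivrMl ?expR_gt0// -expRN -subr_ge0.
pose h (y : R) := 2 - expR (- (y ^+ 2 / 2)) * (expR y + expR (- y)).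
have -> : 0 = h 0.
  by rewrite /h expr0n/= mul0r oppr0 expR0 mul1r; ring.
apply: (@ge0_is_derive_le h (fun y => expR (- (y ^+ 2 / 2)) *
    (y * (expR y + expR (- y)) - (expR y - expR (- y))))) => //.
  by move=> y; apply: is_derive_eq; rewrite /= ?scaler1 /GRing.scale/=; field.
move=> y y0 _; rewrite mulr_ge0 ?expR_ge0// subr_ge0 mul_cosh_ge_sinh//.
exact: ltW.
Qed.

(** From exp(-x) >= 1 - x, since (1 + x + 2 x^2)(1 - x) = 1 + x^2 (1 - 2 x) >= 1 on this range. *)
Lemma expR_le_quad x : 0 <= x -> x <= 2^-1 -> expR x <= 1 + x + 2 * x ^+ 2.
Proof.
move=> x0 x2; have h := expR_ge1Dx (- x).
have E : expR x * expR (- x) = 1 by exact: expRxMexpNx_1.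
have p := expR_gt0 x.
have : expR x * (1 - x) <= 1 by rewrite -[leRHS]E ler_pM2l.
move=> h1; rewrite -(ler_pM2r (_ : 0 < 1 - x)); last lra.
apply: (le_trans h1); nra.
Qed.

(** After inverting and squaring, this is 1 / (1 - 2 x) <= exp(2 x + 8 x^2), which follows from
    exp(u) >= 1 + u. *)
Lemma inv_sqrt_le_expR x : 0 <= x -> x <= 8^-1 ->
  (Num.sqrt (1 - 2 * x))^-1 <= expR (x + 4 * x ^+ 2).
Proof.
move=> x0 x8; rewrite -[leRHS]invrK lef_pV2 ?posrE; last 2 first.
- by rewrite sqrtr_gt0; lra.
- by rewrite invr_gt0 expR_gt0.
rewrite -expRN -[leLHS]ger0_norm ?expR_ge0// -sqrtr_sqr.
apply: ler_wsqrtr; rewrite -expRM_natl mulrN expRN -[leRHS]invrK lef_pV2 ?posrE; last 2 first.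
- by rewrite expR_gt0.
- by rewrite invr_gt0; lra.
apply: le_trans (expR_ge1Dx _).
rewrite -div1r ler_pdivrMr; last lra.
nra.
Qed.

End Calculus.

(** * Expectations of products of independent variables *)

Section WeightedIntegral.
Local Open Scope ereal_scope.
Context d d' (T : measurableType d) (S : measurableType d') (R : realType).
Variables (mu : {measure set T -> \bar R}) (nu : {measure set S -> \bar R}).
Variables (X : T -> S) (W : T -> R).
Hypotheses (mX : measurable_fun [set: T] X) (mW : measurable_fun [set: T] W).
Hypothesis W0 : forall x, (0 <= W x)%R.
Hypothesis nuE : forall B, measurable B ->
  nu B = \int[mu]_x (\1_B (X x) * W x)%:E.

Import HBNNSimple.

(** [nu] is the image under [X] of the measure with density [W] with respect to [mu]; simple
    functions and monotone convergence extend [nuE] from sets to functions. It serves for densities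
    ([X] the identity), for equality of laws ([W] = 1) and for independence ([W] the product of the
    other factors). *)
Lemma integral_weighted (f : S -> \bar R) :
  measurable_fun [set: S] f -> (forall y, 0 <= f y) ->
  \int[nu]_y f y = \int[mu]_x (f (X x) * (W x)%:E).
Proof.
move=> mf f0; pose h := nnsfun_approx measurableT mf.
have hf y : (h n y)%:E @[n --> \oo] --> f y by exact: cvg_nnsfun_approx.
have mh n : measurable_fun [set: S] (h n) by exact/measurable_funP.
have -> : \int[nu]_y f y = lim (\int[nu]_y (h n y)%:E @[n --> \oo]).
  under eq_integral do rewrite -(cvg_lim (@ereal_hausdorff R) (hf _)).
  apply: monotone_convergence => //.
  - by move=> n; exact/measurable_EFinP.
  - by move=> n x _; rewrite lee_fin.
  - by move=> x _ a b ab; rewrite lee_fin; exact/lefP/nd_nnsfun_approx.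
have -> : \int[mu]_x (f (X x) * (W x)%:E) =
    lim (\int[mu]_x ((h n (X x))%:E * (W x)%:E) @[n --> \oo]).
  have fW x : (h n (X x))%:E * (W x)%:E @[n --> \oo] --> f (X x) * (W x)%:E.
    by apply: cvgeZr; [|exact: hf].
  under eq_integral do rewrite -(cvg_lim (@ereal_hausdorff R) (fW _)).
  apply: monotone_convergence => //.
  - move=> n; apply: emeasurable_funM; apply/measurable_EFinP => //.
    exact: measurableT_comp.
  - by move=> n x _; rewrite mule_ge0 ?lee_fin.
  - move=> x _ a b ab; rewrite lee_wpmul2r ?lee_fin//.
    exact/lefP/nd_nnsfun_approx.
suff suf n : \int[nu]_y (h n y)%:E = \int[mu]_x ((h n (X x))%:E * (W x)%:E).
  by under eq_fun do rewrite suf.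
have mind y : measurable_fun [set: T] (fun x => \1_(h n @^-1` [set y]) (X x) * W x)%R.
  apply: measurable_funM => //; apply: (measurableT_comp (measurable_indic _)) => //.
transitivity (\int[mu]_x (\sum_(y \in range (h n))
    (y * (\1_(h n @^-1` [set y]) (X x) * W x))%:E)); last first.
  apply: eq_integral => x xT.
  rewrite fsumEFin// -EFinM; apply: f_equal.
 rewrite [in RHS](fimfunE (h n) (X x)).
  rewrite mulrC mulr_fsumr//; apply: eq_fsbigr => y _.
  by rewrite mulrA mulrC.
rewrite ge0_integral_fsum//; last 2 first.
  by move=> y; apply/measurable_EFinP; exact: measurable_funM.
  move=> y x _; rewrite lee_fin mulrA mulr_ge0//.
  by have := nnfun_muleindic_ge0 (h n) y (X x); rewrite lee_fin.
rewrite integralT_nnsfun sintegralE; apply: eq_fsbigr => y /[!inE] -[z _ yz].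
under [RHS]eq_integral do rewrite EFinM.
rewrite ge0_integralZl//.
- by rewrite nuE.
- exact/measurable_EFinP.
- by move=> x _; rewrite lee_fin mulr_ge0.
- by rewrite lee_fin -yz.
Qed.

End WeightedIntegral.

Section IndependentProduct.
Context {R : realType} {dT : measure_display} {T : measurableType dT}.
Context (P : probability T R) (I : finType) (X : I -> {RV P >-> R}).
Hypothesis indepX : mutually_independent X.

Lemma measurable_preimage_rv i (B : set R) :
  measurable B -> measurable (X i @^-1` B).
Proof. by move=> mB; rewrite -[_ @^-1` _]setTI; exact: measurable_funP. Qed.

Lemma integral_indic_rv i (B : set R) : measurable B ->
  (\int[P]_w (\1_B (X i w))%:E = P (X i @^-1` B))%E.
Proof.
move=> mB; have mA := measurable_preimage_rv i mB.
transitivity (\int[P]_w (\1_(X i @^-1` B) w)%:E)%E.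
  by apply: eq_integral => w _; rewrite !indicE.
by rewrite integral_indic// setIT.
Qed.

Lemma integral_prod_indic (B : I -> set R) : (forall i, measurable (B i)) ->
  (\int[P]_w (\prod_i \1_(B i) (X i w))%:E = \prod_i P (X i @^-1` B i))%E.
Proof.
move=> mB; pose A := \bigcap_(i in [set` [set: I]%SET]) (X i @^-1` B i).
have mA : measurable A.
  apply: fin_bigcap_measurable => // i _.
  exact: measurable_preimage_rv.
transitivity (\int[P]_w (\1_A w)%:E)%E.
  apply: eq_integral => w _; congr EFin; rewrite indicE.
  have [/set_mem wA|] := boolP (w \in A).
    rewrite big1// => i _; rewrite indicE mem_set//.
    by apply: (wA i) => /=; rewrite inE.
  move=> /negP wA.
  have [i iB] : exists i, ~ B i (X i w).
    apply: contrapT => /forallNP h; apply: wA; apply/mem_set => i _.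
    by apply: contrapT => /h.
  by rewrite (bigD1 i)//= indicE memNset ?mul0r.
rewrite integral_indic// setIT; apply: etrans (indepX [set: I]%SET mB) _.
by apply: eq_bigl => i; rewrite inE.
Qed.

(** Induction on a list [s] of indices outside of which every factor is an indicator. With [s] empty
    this is independence of events; each step frees one factor from being an indicator. *)
Lemma integral_prod_indep (g : I -> R -> R) (M : I -> R) :
  (forall i, measurable_fun [set: R] (g i)) -> (forall i x, 0 <= g i x) ->
  (forall i, \int[P]_w (g i (X i w))%:E = (M i)%:E)%E ->
  (\int[P]_w (\prod_i g i (X i w))%:E = (\prod_i M i)%:E)%E.
Proof.
suff H (s : seq I) :
  (forall i, measurable_fun [set: R] (g i)) -> (forall i x, 0 <= g i x) ->
  (forall i, \int[P]_w (g i (X i w))%:E = (M i)%:E)%E ->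
  (forall i, i \notin s -> exists2 B, measurable B & g i = \1_B) ->
  (\int[P]_w (\prod_i g i (X i w))%:E = (\prod_i M i)%:E)%E.
  by move=> mg g0 gM; apply: (H (enum I)) => // i; rewrite mem_enum.
elim: s g M => [|a s IH] g M mg g0 gM gs.
  have {}gs i : exists B, measurable B /\ g i = \1_B.
    by have [//|B ? ?] := gs i; exists B.
  have [B] := choice gs => {}gs.
  under eq_integral do under eq_bigr do rewrite (gs _).2.
  rewrite integral_prod_indic => [|i]; last by have [] := gs i.
  rewrite -prodEFin; apply: eq_bigr => i _; rewrite -gM (gs i).2.
  by rewrite integral_indic_rv//; have [] := gs i.
have M0 i : 0 <= M i.
  by rewrite -lee_fin -gM integral_ge0// => w _; rewrite lee_fin.
pose c := \prod_(i | i != a) M i.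
have c0 : 0 <= c by exact: prodr_ge0.
pose W w := \prod_(i | i != a) g i (X i w).
have mX i : measurable_fun [set: T] (X i) by [].
(* The weight identity required for [nu] is the induction hypothesis with the factor at [a] replaced
   by an indicator. *)
pose nu := mscale (NngNum c0) (distribution P (X a)).
transitivity (\int[nu]_y (g a y)%:E)%E; last first.
  rewrite ge0_integral_mscale//=; last 2 first.
  - exact/measurable_EFinP.
  - by move=> y _; rewrite lee_fin.
  rewrite ge0_integral_pushforward//; last 2 first.
  - exact/measurable_EFinP.
  - by move=> y _; rewrite lee_fin.
  by rewrite preimage_setT /= gM -EFinM mulrC [in RHS](bigD1 a).
rewrite (@integral_weighted _ _ _ _ _ P nu (X a) W)//.
- by apply: eq_integral => w _; rewrite (bigD1 a)//= EFinM.
- rewrite /W; under eq_fun do rewrite -big_filter.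
  by apply: measurable_prod => i _; exact: measurableT_comp.
- by move=> w; exact: prodr_ge0.
- move=> B mB.
  pose g' i := if i == a then \1_B else g i.
  pose M' i := if i == a then fine (P (X a @^-1` B)) else M i.
  have PB : P (X a @^-1` B) \is a fin_num.
    by apply: fin_num_measure; exact: measurable_preimage_rv.
  transitivity (\prod_i M' i)%:E.
    rewrite (bigD1 a)//= {1}/M' eqxx.
    under eq_bigr => i ia do rewrite /M' (negbTE ia).
    by rewrite EFinM fineK// muleC.
  rewrite -(IH g').
  + apply: eq_integral => w _; rewrite (bigD1 a)//= {1}/g' eqxx.
    by under eq_bigr => i ia do rewrite /g' (negbTE ia).
  + by move=> i; rewrite /g'; case: ifP.
  + by move=> i x; rewrite /g'; case: ifP.
  + move=> i; rewrite /g' /M'; case: eqP => [->|//]; rewrite fineK//.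
    exact: integral_indic_rv.
  + move=> i si; rewrite /g'; case: eqP => [_|/eqP ia]; first by exists B.
    by apply: gs; rewrite inE negb_or ia.
- exact/measurable_EFinP.
- by move=> y; rewrite lee_fin.
Qed.

End IndependentProduct.

(** * Gaussian linear forms and their tails *)

Section NormalMoments.
Context {R : realType}.
Local Notation mu := (@lebesgue_measure R).

Lemma integral_normal_prob (m s : R) (f : R -> \bar R) :
  measurable_fun [set: R] f -> (forall x, 0 <= f x)%E ->
  (\int[normal_prob m s]_x f x = \int[mu]_x (f x * (normal_pdf m s x)%:E))%E.
Proof.
move=> mf f0.
apply: (@integral_weighted _ _ _ _ R mu (normal_prob m s) id (normal_pdf m s)) => //.
- exact: measurable_normal_pdf.
- exact: normal_pdf_ge0.
move=> B mB; rewrite /normal_prob [LHS]integral_mkcond; apply: eq_integral => x _.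
by rewrite patchE indicE; case: ifP => _ /=; rewrite ?mul1r ?mul0r.
Qed.

Lemma normal_mgf (s t : R) : s != 0 ->
  (\int[normal_prob 0 s]_x (expR (t * x))%:E = (expR (t ^+ 2 * s ^+ 2 / 2))%:E)%E.
Proof.
move=> s0; rewrite integral_normal_prob; last 2 first.
- apply/measurable_EFinP; apply: (measurableT_comp (@measurable_expR R)).
  exact: measurable_funM.
- by move=> x; rewrite lee_fin expR_ge0.
have s2 : s ^+ 2 != 0 by rewrite expf_eq0.
under eq_integral => x _.
  rewrite normal_pdfE// -EFinM mulrCA /normal_fun -expRD.
  (* Completing the square leaves a normal density recentred at [t * s ^+ 2]. *)
  rewrite (_ : _ + _ = t ^+ 2 * s ^+ 2 / 2 +
    - (x - t * s ^+ 2) ^+ 2 / (s ^+ 2 *+ 2)); last by field; rewrite s0.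
  rewrite expRD mulrCA -[expR (- _ / _)]/(normal_fun (t * s ^+ 2) s x).
  rewrite -[_ * normal_fun _ _ _](congr1 (@^~ x) (normal_pdfE _ s0)) EFinM; over.
rewrite ge0_integralZl//; last 2 first.
- apply/measurable_EFinP; exact: measurable_normal_pdf.
- by move=> x _; rewrite lee_fin normal_pdf_ge0.
by rewrite integral_normal_pdf mule1.
Qed.

Lemma normal_square_mgf (l : R) : l < 2^-1 ->
  (\int[normal_prob 0 1]_x (expR (l * x ^+ 2))%:E =
    ((Num.sqrt (1 - 2 * l))^-1)%:E)%E.
Proof.
move=> l2; rewrite integral_normal_prob; last 2 first.
- apply/measurable_EFinP; apply: (measurableT_comp (@measurable_expR R)).
  apply: measurable_funM => //; exact: measurable_funX.
- by move=> x; rewrite lee_fin expR_ge0.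
have a0 : 0 < 1 - 2 * l by lra.
(* exp(l x^2) times the standard normal density is [s] times the centred normal density of standard
   deviation [s]. *)
pose s := (Num.sqrt (1 - 2 * l))^-1.
have sgt0 : 0 < s by rewrite invr_gt0 sqrtr_gt0.
have s0 : s != 0 by rewrite gt_eqF.
have s2 : s ^+ 2 = (1 - 2 * l)^-1 by rewrite exprVn sqr_sqrtr// ltW.
under eq_integral => x _.
  rewrite normal_pdfE ?oner_neq0// -EFinM mulrCA /normal_fun -expRD.
  rewrite (_ : _ + _ = - (x - 0) ^+ 2 / (s ^+ 2 *+ 2)); last first.
    by rewrite s2; field; rewrite gt_eqF.
  rewrite -[expR (- _ / _)]/(normal_fun 0 s x).
  rewrite (_ : _ * _ = s * normal_pdf 0 s x); last first.
    rewrite normal_pdfE// mulrA; congr (_ * _).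
    rewrite /normal_peak -[s ^+ 2 * _ *+ 2]mulrnAr sqrtrM ?sqr_ge0// sqrtr_sqr.
    by rewrite gtr0_norm// invfM mulrA divff// mul1r expr1n mul1r.
  rewrite EFinM; over.
rewrite ge0_integralZl//; last 3 first.
- apply/measurable_EFinP; exact: measurable_normal_pdf.
- by move=> x _; rewrite lee_fin normal_pdf_ge0.
- by rewrite lee_fin ltW.
by rewrite integral_normal_pdf mule1.
Qed.

End NormalMoments.

Section GaussianSensing.
Context {R : realType} {dT : measure_display} {T : measurableType dT}.
Context (P : probability T R) (m n d : nat).
Context (Z : 'I_d -> 'I_m -> 'I_n -> {RV P >-> R}).
Hypothesis gaussZ : iid_gaussian_entries Z.
Hypothesis d_gt0 : (0 < d)%N.
Variable G : 'M[R]_(m, n).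

Definition gform i w := frob_dot (random_sensing Z w i) G.

Lemma gformE i w : gform i w = \sum_a \sum_b G a b * Z i a b w.
Proof.
rewrite /gform frob_dotE; apply: eq_bigr => a _; apply: eq_bigr => b _.
by rewrite mxE mulrC.
Qed.

Lemma measurable_gform i : measurable_fun [set: T] (gform i).
Proof.
rewrite (_ : gform i = fun w => \sum_a \sum_b G a b * Z i a b w); last first.
  by apply/funext => w; exact: gformE.
by do 2![apply: measurable_sum => ?]; exact: measurable_funM.
Qed.

(** The forms have the joint moment generating function of independent centred Gaussians of variance
    |G|^2 / d. Both tail bounds get their distributional input from this formula alone. *)
Lemma gform_mgf (t : 'I_d -> R) :
  (\int[P]_w (\prod_i expR (t i * gform i w))%:E =
   (\prod_i expR (t i ^+ 2 * frob_norm G ^+ 2 / (2 * d%:R)))%:E)%E.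
Proof.
have [indep norm] := gaussZ; have dR : 0 < d%:R :> R by rewrite ltr0n.
pose c (a : 'I_d * 'I_m * 'I_n) : R := t a.1.1 * G a.1.2 a.2.
pose M a := expR (c a ^+ 2 * (Num.sqrt d%:R^-1) ^+ 2 / 2).
transitivity (\int[P]_w (\prod_a expR (c a * Z a.1.1 a.1.2 a.2 w))%:E)%E.
  apply: eq_integral => w _; congr EFin; rewrite -!expR_sum; congr expR.
  rewrite -(pair_bigA _ (fun a b => c (a, b) * Z a.1 a.2 b w)) /=.
  rewrite -(pair_bigA _ (fun i a => \sum_b c (i, a, b) * Z i a b w)) /=.
  apply: eq_bigr => i _; rewrite gformE mulr_sumr; apply: eq_bigr => a _.
  by rewrite mulr_sumr; apply: eq_bigr => b _; rewrite mulrA.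
rewrite (integral_prod_indep (g := fun a x => expR (c a * x)) (M := M) indep).
- congr EFin; rewrite /M -!expR_sum; congr expR.
  rewrite -(pair_bigA _ (fun a b => c (a, b) ^+ 2 * Num.sqrt d%:R^-1 ^+ 2 / 2)) /=.
  rewrite -(pair_bigA _ (fun i a => \sum_b c (i, a, b) ^+ 2 * Num.sqrt d%:R^-1 ^+ 2 / 2)) /=.
  apply: eq_bigr => i _; rewrite sqr_frob_norm frob_dotE mulr_sumr mulr_suml.
  apply: eq_bigr => a _; rewrite mulr_sumr mulr_suml; apply: eq_bigr => b _.
  rewrite /c /= sqr_sqrtr ?invr_ge0 ?ler0n//.
  by field; rewrite gt_eqF.
- move=> a; apply: (measurableT_comp (@measurable_expR R)); exact: measurable_funM.
- by move=> a x; exact: expR_ge0.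
move=> a; rewrite -(normal_mgf (c a) (_ : Num.sqrt d%:R^-1 != 0)); last first.
  by rewrite sqrtr_eq0 -ltNge invr_gt0.
transitivity (\int[distribution P (Z a.1.1 a.1.2 a.2)]_x (expR (c a * x))%:E)%E.
  rewrite ge0_integral_pushforward ?preimage_setT//.
  apply/measurable_EFinP; apply: (measurableT_comp (@measurable_expR R)).
  exact: measurable_funM.
rewrite (@integral_weighted _ _ _ _ R (normal_prob 0 (Num.sqrt d%:R^-1))
  (distribution P (Z a.1.1 a.1.2 a.2)) id (cst 1))//.
- by under eq_integral do rewrite mule1.
- move=> B mB; apply: etrans (norm _ _ _ _ mB) _.
  under eq_integral do rewrite mulr1.
  by rewrite integral_indic// setIT.
- apply/measurable_EFinP; apply: (measurableT_comp (@measurable_expR R)).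
  exact: measurable_funM.
Qed.

Hypothesis G1 : frob_norm G = 1.

(** Coordinates are converted one at a time from a linear to a quadratic exponent: exp(l d x^2) is
    the mean of exp(c h x) over a standard normal h, and Tonelli exchanges the two integrals. *)
Lemma gform_square_mgf (l : R) : 0 <= l -> l < 2^-1 ->
  (\int[P]_w (expR (l * d%:R * \sum_i gform i w ^+ 2))%:E =
   ((Num.sqrt (1 - 2 * l))^-1 ^+ d)%:E)%E.
Proof.
move=> l0 l2; have dR : 0 < d%:R :> R by rewrite ltr0n.
(* [J] lists the coordinates already converted; the others keep a free parameter [t i], on which the
   induction relies. *)
pose Phi (J : seq 'I_d) t i w :=
  if i \in J then expR (l * d%:R * gform i w ^+ 2) else expR (t i * gform i w).
pose phi (J : seq 'I_d) (t : 'I_d -> R) i :=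
  if i \in J then (Num.sqrt (1 - 2 * l))^-1 else expR (t i ^+ 2 / (2 * d%:R)).
have mPhi J t i : measurable_fun [set: T] (Phi J t i).
  rewrite /Phi; case: (i \in J); apply: (measurableT_comp (@measurable_expR R)).
    apply: measurable_funM => //; apply: measurable_funX; exact: measurable_gform.
  by apply: measurable_funM => //; exact: measurable_gform.
have Phi0 J t i w : 0 <= Phi J t i w by rewrite /Phi; case: ifP => _; exact: expR_ge0.
have phi0 J t i : 0 <= phi J t i.
  by rewrite /phi; case: ifP => _; rewrite ?expR_ge0// invr_ge0 sqrtr_ge0.
suff H J t : uniq J -> (\int[P]_w (\prod_i Phi J t i w)%:E = (\prod_i phi J t i)%:E)%E.
  transitivity ((\prod_i phi (enum 'I_d) (fun=> 0) i)%:E)%E; last first.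
    congr EFin; rewrite (eq_bigr (fun=> (Num.sqrt (1 - 2 * l))^-1)).
      by rewrite prodr_const card_ord.
    by move=> i _; rewrite /phi mem_enum.
  rewrite -H ?enum_uniq//; apply: eq_integral => w _; congr EFin.
  rewrite mulr_sumr expR_sum; apply: eq_bigr => i _.
  by rewrite /Phi mem_enum.
elim: J t => [|a J IH] t /=.
  move=> _; rewrite gform_mgf; congr EFin; apply: eq_bigr => i _.
  by rewrite /phi G1 expr1n mulr1.
move=> /andP[aJ uJ].
(* Chosen so that c^2 / 2 = l d. On the other side the parameter c h contributes exp((c h)^2 / (2
   d)) = exp(l h^2), whose normal mean is the new factor. *)
pose c := Num.sqrt (2 * l * d%:R).
have c2 : c ^+ 2 = 2 * l * d%:R by rewrite sqr_sqrtr// !mulr_ge0// ltW.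
pose t' h i := if i == a then c * h else t i.
pose rest w := \prod_(i | i != a) Phi J t i w.
have rest0 w : 0 <= rest w by exact: prodr_ge0.
have Phi' h w : \prod_i Phi J (t' h) i w = rest w * expR (c * gform a w * h).
  rewrite (bigD1 a)//= mulrC /Phi (negbTE aJ) {2}/t' eqxx (mulrAC c); congr (_ * _).
  by apply: eq_bigr => i ia; rewrite /t' (negbTE ia).
have phi' h : \prod_i phi J (t' h) i =
    (\prod_(i | i != a) phi J t i) * expR (l * h ^+ 2).
  rewrite (bigD1 a)//= mulrC /phi (negbTE aJ) {2}/t' eqxx exprMn c2; congr (_ * _).
    by apply: eq_bigr => i ia; rewrite /t' (negbTE ia).
  by congr expR; field; rewrite gt_eqF.
have stepPhi w : (\prod_i Phi (a :: J) t i w)%:E =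
    (\int[normal_prob 0 1]_h (\prod_i Phi J (t' h) i w)%:E)%E.
  under eq_integral do rewrite Phi' EFinM.
  rewrite ge0_integralZl//; last 2 first.
  - apply/measurable_EFinP; apply: (measurableT_comp (@measurable_expR R)).
    exact: measurable_funM.
  - by rewrite lee_fin.
  rewrite normal_mgf ?oner_neq0// -EFinM (bigD1 a)//= mulrC; congr ((_ * _)%:E).
    apply: eq_bigr => i ia; rewrite /Phi inE (negbTE ia)//.
  by rewrite /Phi inE eqxx/= exprMn c2; congr expR; field.
under eq_integral do rewrite stepPhi.
pose N01 : probability (measurableTypeR R) R := normal_prob 0 1.
pose F (wh : T * measurableTypeR R) := (\prod_i Phi J (t' wh.2) i wh.1)%:E.
have mF : measurable_fun [set: T * measurableTypeR R] F.
  apply/measurable_EFinP; rewrite /F; under eq_fun do rewrite Phi'.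
  have mg i : measurable_fun [set: T * measurableTypeR R] (fun x => gform i x.1).
    apply: (measurableT_comp (measurable_gform i)); exact: measurable_fst.
  apply: measurable_funM.
    rewrite /rest; under eq_fun do rewrite -big_filter.
    apply: measurable_prod => i _.
    apply: (measurableT_comp (mPhi J t i)); exact: measurable_fst.
  apply: (measurableT_comp (@measurable_expR R)).
  apply: measurable_funM; first exact: measurable_funM.
  exact: measurable_snd.
have F0 wh : (0 <= F wh)%E by rewrite lee_fin prodr_ge0.
rewrite -[LHS]/(\int[P]_w \int[N01]_h F (w, h))%E.
rewrite (@fubini_tonelli _ _ _ _ _ P N01 F mF F0).
have inner h : (\int[P]_w F (w, h) =
    (\prod_(i | i != a) phi J t i)%:E * (expR (l * h ^+ 2))%:E)%E.
  by rewrite -EFinM -phi' -IH.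
under eq_integral do rewrite inner.
rewrite ge0_integralZl//; last 2 first.
- apply/measurable_EFinP; apply: (measurableT_comp (@measurable_expR R)).
  by apply: measurable_funM => //; exact: measurable_funX.
- by rewrite lee_fin prodr_ge0.
rewrite normal_square_mgf// -EFinM [in RHS](bigD1 a)//= [in RHS]mulrC.
congr ((_ * _)%:E).
  by apply: eq_bigr => i ia; rewrite /phi inE (negbTE ia).
by rewrite /phi inE eqxx.
Qed.

End GaussianSensing.

(** * Exponential tails of |Z(G)|^2 for a fixed matrix G of norm 1 *)

Section Tails.
Context {R : realType} {dT : measure_display} {T : measurableType dT}.
Context (P : probability T R).

Lemma markov_ge0 (Y : T -> R) (M b : R) (A : set T) :
  measurable A -> measurable_fun [set: T] Y -> (forall w, 0 <= Y w) ->
  (\int[P]_w (Y w)%:E = M%:E)%E ->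
  0 < b -> (forall w, A w -> b <= Y w) -> (P A <= (M / b)%:E)%E.
Proof.
move=> mA mY Y0 YM b0 AY.
rewrite EFinM muleC -YM -ge0_integralZl//; last 3 first.
- exact/measurable_EFinP.
- by move=> w _; rewrite lee_fin.
- by rewrite lee_fin invr_ge0 ltW.
rewrite -(setIT A) -integral_indic//; apply: ge0_le_integral => //.
- exact/measurable_EFinP.
- by apply: measurable_funeM; exact/measurable_EFinP.
- move=> w _; rewrite -EFinM lee_fin indicE.
  have [/set_mem /AY bY|_] := boolP (w \in A).
    by rewrite mulrC ler_pdivlMr// mul1r.
  by rewrite mulr_ge0// invr_ge0 ltW.
Qed.

Context (m n d : nat) (Z : 'I_d -> 'I_m -> 'I_n -> {RV P >-> R}).
Hypothesis gaussZ : iid_gaussian_entries Z.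
Hypothesis d_gt0 : (0 < d)%N.
Variable G : 'M[R]_(m, n).
Hypothesis G1 : frob_norm G = 1.
Local Notation s := (gform Z G).

Let measurable_sum_sqr : measurable_fun [set: T] (fun w => \sum_i s i w ^+ 2).
Proof.
by apply: measurable_sum => i; apply: measurable_funX; exact: measurable_gform.
Qed.

Lemma upper_tail (e : R) : 0 < e -> e <= 1 ->
  (P [set w | (1 + e <= \sum_i s i w ^+ 2)%R] <=
     (expR (- (d%:R * e ^+ 2 / 64)))%:E)%E.
Proof.
(* Per coordinate the Chernoff exponent is l + 4 l^2 - l (1 + e) = - e^2 / 16, stronger than the
   stated rate. *)
move=> e0 e1; pose l := e / 8.
have l2 : l < 2^-1 by rewrite /l; lra.
have l0 : 0 < l by rewrite /l; lra.
have dR : 0 < d%:R :> R by rewrite ltr0n.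
have := @markov_ge0 (fun w => expR (l * d%:R * \sum_i s i w ^+ 2))
  ((Num.sqrt (1 - 2 * l))^-1 ^+ d) (expR (l * d%:R * (1 + e)))
  [set w | 1 + e <= \sum_i s i w ^+ 2].
move=> /(_ _ _ _ (gform_square_mgf gaussZ d_gt0 G1 (ltW l0) l2) (expR_gt0 _)) H.
apply: (le_trans (H _ _ _ _)).
- rewrite -[X in measurable X]setTI; apply: measurable_fun_le => //.
- apply: (measurableT_comp (@measurable_expR R)); exact: measurable_funM.
- by move=> w; exact: expR_ge0.
- by move=> w /= ew; rewrite ler_expR ler_pM2l// mulr_gt0.
rewrite lee_fin ler_pdivrMr ?expR_gt0// -expRD.
apply: (@le_trans _ _ (expR (l + 4 * l ^+ 2) ^+ d)).
  apply: lerXn2r; rewrite ?nnegrE ?expR_ge0 ?invr_ge0 ?sqrtr_ge0//.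
  by apply: inv_sqrt_le_expR; rewrite /l; lra.
rewrite -expRM_natl ler_expR /l.
rewrite -subr_ge0 (_ : _ - _ = d%:R * (3 * e ^+ 2 / 64)); last by field.
by rewrite !mulr_ge0// ?sqr_ge0// ltW.
Qed.

(** Expanding the product over all choice functions reduces it to [gform_mgf]. The coefficients may
    be negative, hence the passage through integrability. *)
Lemma gform_exp_comb (J : finType) (c tau : J -> R) :
  (\int[P]_w (\prod_i \sum_j c j * expR (tau j * s i w))%:E =
   ((\sum_j c j * expR (tau j ^+ 2 / (2 * d%:R))) ^+ d)%:E)%E.
Proof.
have mY (f : {ffun 'I_d -> J}) :
    measurable_fun [set: T] (fun w => \prod_i expR (tau (f i) * s i w)).
  apply: measurable_prod => i _; apply: (measurableT_comp (@measurable_expR R)).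
  by apply: measurable_funM => //; exact: measurable_gform.
have intY (f : {ffun 'I_d -> J}) :
    P.-integrable [set: T] (fun w => (\prod_i expR (tau (f i) * s i w))%:E).
  apply/integrableP; split; first exact/measurable_EFinP.
  under eq_integral do rewrite gee0_abs ?lee_fin ?prodr_ge0//.
  by rewrite (gform_mgf gaussZ d_gt0) ltry.
transitivity (\int[P]_w (\sum_(f : {ffun 'I_d -> J})
   (\prod_i c (f i))%:E * (\prod_i expR (tau (f i) * s i w))%:E))%E.
  apply: eq_integral => w _; rewrite sumEFin; congr EFin; rewrite bigA_distr_bigA.
  by apply: eq_bigr => f _; rewrite big_split.
rewrite integral_sum//; last by move=> f; exact: integrableZl.
under eq_bigr => f _.
  rewrite integralZl// (gform_mgf gaussZ d_gt0) -EFinM -big_split /=.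
  under eq_bigr do rewrite G1 expr1n mulr1.
  over.
rewrite sumEFin; congr EFin.
rewrite -(bigA_distr_bigA (fun _ j => c j * expR (tau j ^+ 2 / (2 * d%:R)))).
by rewrite prodr_const card_ord.
Qed.

(* 1 - u + u ^+ 2 for u = cosh x - 1 equals 7 / 2 - 3 cosh x + cosh (2 x) / 2. *)
Let c5 : 'I_5 -> R := fun j => [:: 7 / 2; - (3 / 2); - (3 / 2); 1 / 4; 1 / 4]`_j.
Let t5 : 'I_5 -> R := fun j => [:: 0; 1; - 1; 2; - 2]`_j.

Lemma comb5_ge x : expR (- (x ^+ 2 / 2)) <= \sum_j c5 j * expR (t5 j * x).
Proof.
rewrite !big_ord_recl big_ord0 /c5 /t5 /= mul0r expR0 mul1r !mulNr mul1r.
set y := expR x; set z := expR (- x).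
have -> : expR (2 * x) = y ^+ 2 by rewrite expRM_natl.
have -> : expR (- (2 * x)) = z ^+ 2 by rewrite -mulrN expRM_natl.
have yz : y * z = 1 by exact: expRxMexpNx_1.
have y0 : 0 < y := expR_gt0 _; have z0 : 0 < z := expR_gt0 _.
have := cosh_le_expR_sqr x; rewrite -/y -/z expRN => h.
have h0 : 0 < (y + z) / 2 by rewrite divr_gt0 ?addr_gt0.
apply: (@le_trans _ _ ((y + z) / 2)^-1).
  by rewrite lef_pV2 ?posrE ?expR_gt0.
have u0 : 0 <= (y + z) / 2 - 1 by have := sqr_ge0 (y - z); nra.
rewrite -div1r ler_pdivrMr//.
set u := (y + z) / 2 - 1 in u0.
have -> : 7 / 2 * 1 + (- (3 / 2 * y) + (- (3 / 2 * z) +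
    (4^-1 * y ^+ 2 + (4^-1 * z ^+ 2 + 0)))) =
    1 - u + u ^+ 2 + 1 / 2 - (y * z) / 2.
  by rewrite /u; field.
have -> : (y + z) / 2 = 1 + u by rewrite /u; ring.
(* (1 - u + u^2)(1 + u) = 1 + u^3 >= 1. *)
rewrite yz; have := exprn_ge0 3 u0; nra.
Qed.

Lemma lower_tail (e : R) : 0 < e -> e <= 1 ->
  (P [set w | (\sum_i s i w ^+ 2 <= 1 - e)%R] <=
     (expR (- (d%:R * e ^+ 2 / 64)))%:E)%E.
Proof.
(* [th] minimizes the final exponent 16 th^2 - e th, with value - e^2 / 64; [u] makes [comb5_ge] at
   u s_i bound exp(- th d s_i^2). *)
move=> e0 e1; pose th := e / 32; pose u := Num.sqrt (2 * th * d%:R).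
have th0 : 0 < th by rewrite /th; lra.
have dR : 0 < d%:R :> R by rewrite ltr0n.
have u2 : u ^+ 2 = 2 * th * d%:R by rewrite sqr_sqrtr// !mulr_ge0// ltW.
pose Y w := \prod_i \sum_j c5 j * expR (t5 j * u * s i w).
have YE w : expR (- (th * d%:R * \sum_i s i w ^+ 2)) <= Y w.
  rewrite mulr_sumr -sumrN expR_sum; apply: ler_prod => i _; rewrite expR_ge0/=.
  under eq_bigr do rewrite -[t5 _ * u * _]mulrA.
  apply: le_trans (comb5_ge _); rewrite ler_expR lerN2 exprMn u2.
  by rewrite le_eqVlt; apply/orP; left; apply/eqP; field.
have mY : measurable_fun [set: T] Y.
  apply: measurable_prod => i _; apply: measurable_sum => j.
  apply: measurable_funM => //; apply: (measurableT_comp (@measurable_expR R)).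
  by apply: measurable_funM => //; exact: measurable_gform.
have := @markov_ge0 Y _ (expR (- (th * d%:R * (1 - e))))
  [set w | \sum_i s i w ^+ 2 <= 1 - e] _ mY _
  (gform_exp_comb c5 (fun j => t5 j * u)) (expR_gt0 _) _.
move=> H; apply: (le_trans (H _ _ _)).
- by rewrite -[X in measurable X]setTI; apply: measurable_fun_le.
- by move=> w; apply: le_trans (YE w); exact: expR_ge0.
- move=> w /= ew; apply: le_trans (YE w); rewrite ler_expR lerN2 ler_pM2l//.
  by rewrite mulr_gt0.
rewrite lee_fin ler_pdivrMr ?expR_gt0// -expRD.
apply: (@le_trans _ _ (expR (- th + 16 * th ^+ 2) ^+ d)); last first.
  rewrite -expRM_natl ler_expR -subr_ge0 /th.
  rewrite (_ : _ - _ = 0) //; by field.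
have E t : expR ((t * u) ^+ 2 / (2 * d%:R)) = expR (t ^+ 2 * th).
  by congr expR; rewrite exprMn u2; field; rewrite gt_eqF.
under eq_bigr do rewrite E.
(* The base is 7/2 - 3 exp(th) + exp(4 th) / 2. Bounding exp(th) below to first order and exp(4 th)
   above to second order gives at most 1 - th + 16 th^2. *)
rewrite !big_ord_recl big_ord0 /c5 /t5 /= expr0n/= mul0r expR0 sqrrN !expr1n mul1r addr0.
have := expR_ge1Dx th.
have : expR (2 ^+ 2 * th) <= 1 + 2 ^+ 2 * th + 2 * (2 ^+ 2 * th) ^+ 2.
  by apply: expR_le_quad; rewrite /th; lra.
have := expR_ge1Dx (- th + 16 * th ^+ 2).
rewrite sqrrN.
set A := expR (- th + _); set B := expR (_ * th); set C := expR th => h1 h2 h3.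
have hC : C <= 1 + th + 2 * th ^+ 2 by apply: expR_le_quad; rewrite /th; lra.
have B0 : 0 <= B := expR_ge0 _.
have th2 : th ^+ 2 <= 1 / 16 by rewrite /th; nra.
have th1 : th <= 1 / 32 by rewrite /th; lra.
by apply: lerXn2r; rewrite ?nnegrE ?expR_ge0//; lra.
Qed.

End Tails.

(** * Nets of low-rank matrices *)

Section Net.
Context {R : realType} (p q : nat).
(** [body a] plays the ball of radius [a] of a norm, later the Frobenius or the operator norm, and
    [kappa] compares that norm with the maximum norm. *)
Variables (body : R -> 'M[R]_(p, q) -> Prop) (kappa : R).
Hypothesis body_add : forall a b (x y : 'M[R]_(p, q)),
  body a x -> body b y -> body (a + b) (x + y).
Hypothesis body_scale : forall (a c : R) (x : 'M[R]_(p, q)),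
  body a x -> body (`|c| * a) (c *: x).
Hypothesis body_mono : forall a b (x : 'M[R]_(p, q)),
  a <= b -> body a x -> body b x.
Hypothesis body_coord : forall a (x : 'M[R]_(p, q)) i j, body a x -> `|x i j| <= a.
Hypothesis kappa_gt0 : 0 < kappa.
Hypothesis body_sup : forall (e : R) (x : 'M[R]_(p, q)),
  0 <= e -> (forall i j, `|x i j| <= e) -> body (kappa * e) x.

Section Grid.
Variables (k : nat) (h : R) (B : nat).
Hypotheses (k_gt0 : (0 < k)%N) (h_gt0 : 0 < h) (hB : 2 <= h * B%:R).
Local Notation eps := (k%:R^-1 : R).
Local Notation Q := (16 * k)%N.
Local Notation grid := 'M['I_(2 * B).+1]_(p, q).

(** Lattice points of mesh [h]. An index in 0..2B encodes the integer coordinate shifted by [B];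
    [lf] inverts this encoding on [body 2], where [hB] keeps all coordinates in range. *)
Let E (v : 'M[int]_(p, q)) : 'M[R]_(p, q) := h *: map_mx intr v.
Let iv (z : grid) : 'M[int]_(p, q) := \matrix_(i, j) ((z i j)%:Z - B%:Z).
Let lf (v : 'M[int]_(p, q)) : grid := \matrix_(i, j) inord `|(v i j + B%:Z)%R|%N.
Let ball rho : {set grid} := [set z | `[< body rho (E (iv z)) >]].

Let ED u v : E (u + v) = E u + E v.
Proof. by rewrite /E map_mxD scalerDr. Qed.

Let EB u v : E (u - v) = E u - E v.
Proof. by rewrite /E map_mxB scalerBr. Qed.

Let E0 : E 0 = 0.
Proof. by rewrite /E map_mx0 scaler0. Qed.

Let iv_inj : injective iv.
Proof.
move=> y z /matrixP yz; apply/matrixP => i j; apply: val_inj => /=.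
by have := yz i j; rewrite !mxE; lia.
Qed.

Let lfK v : body 2 (E v) -> iv (lf v) = v.
Proof.
move=> bv; apply/matrixP => i j; rewrite !mxE.
have : `|v i j| <= B%:Z.
  rewrite -(ler_int R) -(ler_pM2l h_gt0) intr_norm -{1}(gtr0_norm h_gt0) -normrM.
  have := body_coord i j bv; rewrite !mxE => /le_trans; apply; exact: hB.
rewrite ler_norml => /andP[v1 v2].
rewrite inordK; lia.
Qed.

Let ballP rho z : reflect (body rho (E (iv z))) (z \in ball rho).
Proof. by rewrite inE; exact: asboolP. Qed.

Let bodyB a b x y : body a x -> body b y -> body (a + b) (x - y).
Proof.
move=> ax bY; rewrite -scaleN1r; apply: body_add => //.
by have := body_scale (-1) bY; rewrite normrN1 mul1r.
Qed.

Let body0 a : 0 <= a -> body a 0.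
Proof.
move=> a0; apply: (@body_mono (kappa * 0)); first by rewrite mulr0.
by apply: body_sup => // i j; rewrite mxE normr0.
Qed.

Let k_gt0R : 0 < k%:R :> R. Proof. by rewrite ltr0n. Qed.
Let eps_gt0 : 0 < eps. Proof. by rewrite invr_gt0. Qed.
Let eps_le1 : eps <= 1. Proof. by rewrite invf_le1// ler1n. Qed.

(* Two lattice points of the big body that agree modulo [Q] differ by [Q] times
   a lattice point of the small one, so the small body and the [Q ^ (p * q)]
   residue classes bound the big one. *)
Let ball_doubling : (#|ball 2| <= Q ^ (p * q) * #|ball (eps / 4)|)%N.
Proof.
pose cl (z : grid) : 'M['I_Q.-1.+1]_(p, q) := \matrix_(i, j) inord (z i j %% Q).
have Q0 : (0 < Q)%N by rewrite muln_gt0.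
have clE y z : cl y = cl z -> exists w, iv y - iv z = Q%:Z *: w.
  move=> /matrixP yz; exists (\matrix_(i, j) (((y i j)%:Z - (z i j)%:Z) %/ Q%:Z)%Z).
  apply/matrixP => i j; have := congr1 val (yz i j); rewrite !mxE /=.
  rewrite !inordK ?prednK ?ltn_pmod// => yzQ.
  have : (Q%:Z %| (y i j)%:Z - (z i j)%:Z)%Z.
    by rewrite -eqz_mod_dvd !modz_nat; apply/eqP; congr Posz.
  by move=> /divzK dE; rewrite [RHS]mulrC dE; ring.
(* The default value is reached only for residue classes that miss [ball 2]. *)
pose rep (c : 'M['I_Q.-1.+1]_(p, q)) : grid :=
  odflt (\matrix_(i, j) ord0) [pick z in ball 2 | cl z == c].
have repP z : z \in ball 2 -> rep (cl z) \in ball 2 /\ cl (rep (cl z)) = cl z.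
  move=> zb; rewrite /rep; case: pickP => [y /andP[yb /eqP yz]//|/(_ z)].
  by rewrite zb eqxx.
pose g (z : grid) :=
  (cl z, lf (map_mx (fun a => (a %/ Q%:Z)%Z) (iv z - iv (rep (cl z))))).
have gP z : z \in ball 2 -> (g z).2 \in ball (eps / 4) /\
    iv z = iv (rep (cl z)) + Q%:Z *: iv (g z).2.
  move=> zb; have [rb rc] := repP z zb; have [w wE] := clE _ _ (esym rc).
  have gw : map_mx (fun a => (a %/ Q%:Z)%Z) (iv z - iv (rep (cl z))) = w.
    apply/matrixP => i j; rewrite wE !mxE mulrC mulzK//; lia.
  have bw : body (eps / 4) (E w).
    (* Two points of radius 2 differ by radius at most 4, and 4 / (16 k) = eps / 4. *)
    have -> : E w = Q%:R^-1 *: (E (iv z) - E (iv (rep (cl z)))).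
      rewrite -EB wE /E; apply/matrixP => i j; rewrite !mxE intrM /=.
      field; rewrite pnatr_eq0; lia.
    have := body_scale Q%:R^-1 (bodyB (ballP _ _ zb) (ballP _ _ rb)).
    rewrite ger0_norm ?invr_ge0 ?ler0n// natrM; apply: body_mono.
    by rewrite le_eqVlt; apply/orP; left; apply/eqP; field; rewrite gt_eqF.
  have lw : iv (lf w) = w by apply: lfK; apply: body_mono bw; have := eps_le1; lra.
  rewrite /g /= gw lw; split; first by apply/ballP; rewrite lw.
  by rewrite -wE addrC subrK.
have ginj : {in ball 2 &, injective g}.
  move=> y z yb zb gyz; apply: iv_inj.
  have cyz : cl y = cl z := congr1 (fun u => u.1) gyz.
  by rewrite (gP y yb).2 (gP z zb).2 gyz cyz.
rewrite -(card_in_imset ginj).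
have -> : (Q ^ (p * q) * #|ball (eps / 4)|)%N =
    #|finset.setX [set: 'M['I_Q.-1.+1]_(p, q)]%SET (ball (eps / 4))|.
  by rewrite cardsX cardsT card_mx card_ord prednK.
apply: subset_leq_card; apply/fintype.subsetP => y /imsetP[z zb ->].
by apply/finset.setXP; split; [rewrite inE|have [] := gP z zb].
Qed.

(** Packing argument with lattice counting in place of volume. For a maximal (eps / 2)-separated set
    in the unit body, the translates of [ball (eps / 4)] are disjoint inside [ball 2], so
    [ball_doubling] bounds their number; maximality makes the set a net. *)
Lemma grid_net : exists s : seq 'M[R]_(p, q),
  [/\ (size s <= Q ^ (p * q))%N, forall y, y \in s -> body 1 y
    & forall v : 'M[int]_(p, q), body 1 (h *: map_mx intr v) ->
      exists2 y, y \in s & body (eps / 2) (h *: map_mx intr v - y)].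
Proof.
pose sep (S : {set grid}) := (S \subset ball 1) &&
  [forall y in S, forall z in S, (y != z) ==>
    ~~ `[< body (eps / 2) (E (iv y) - E (iv z)) >]].
have sep0 : sep finset.set0.
  by apply/andP; split; [exact: finset.sub0set|apply/forall_inP => y; rewrite inE].
case: (arg_maxnP (fun S : {set grid} => #|S|) sep0) => S /andP[Sb Ssep] Smax.
have sepP y z : y \in S -> z \in S -> body (eps / 2) (E (iv y) - E (iv z)) -> y = z.
  move=> yS zS yz; apply/eqP/negP => /negP yNz.
  have /forall_inP/(_ _ zS) := forall_inP Ssep _ yS.
  by rewrite yNz/= => /negP; apply; exact/asboolP.
exists [seq E (iv z) | z <- enum S]; split.
- rewrite size_map -cardE.
  have b0 : (0 < #|ball (eps / 4)|)%N.
    apply/card_gt0P; exists (lf 0); apply/ballP.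
    rewrite lfK ?E0; apply: body0; have := eps_gt0; lra.
  rewrite -(leq_pmul2r b0); apply: leq_trans ball_doubling.
  pose g (u : grid * grid) := lf (iv u.1 + iv u.2).
  have gP u : u \in finset.setX S (ball (eps / 4)) ->
      iv (g u) = iv u.1 + iv u.2 /\ body 2 (E (iv u.1 + iv u.2)).
    case: u => y z /finset.setXP[/(fintype.subsetP Sb)/ballP b1 /ballP b2] /=.
    have b3 : body 2 (E (iv y + iv z)).
      rewrite ED; apply: body_mono (body_add b1 b2); have := eps_le1; lra.
    by split=> //; rewrite /g lfK.
  have ginj : {in finset.setX S (ball (eps / 4)) &, injective g}.
    move=> u v uS vS guv.
    have : iv u.1 + iv u.2 = iv v.1 + iv v.2.
      by rewrite -(gP u uS).1 guv (gP v vS).1.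
    case: u v uS vS {guv} => [u1 u2] [v1 v2] /= /finset.setXP[uS /ballP bu].
    move=> /finset.setXP[vS /ballP bv] uv.
    have uv1 : u1 = v1.
      apply: sepP => //; rewrite -EB.
      have -> : iv u1 - iv v1 = iv v2 - iv u2.
        by apply/eqP; rewrite subr_eq addrAC eq_sym subr_eq addrC uv addrC.
      rewrite EB; apply: body_mono (bodyB bv bu); lra.
    by congr pair => //; apply: iv_inj; move: uv; rewrite uv1 => /addrI.
  rewrite -cardsX -(card_in_imset ginj); apply: subset_leq_card.
  apply/fintype.subsetP => z /imsetP[u uS ->]; apply/ballP.
  by rewrite (gP u uS).1; exact: (gP u uS).2.
- move=> y /mapP[z]; rewrite mem_enum => zS ->.
  exact/ballP/(fintype.subsetP Sb).
- move=> v; rewrite -/(E v) => bv.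
  have <- : iv (lf v) = v by apply: lfK; apply: body_mono bv; lra.
  have bz : body 1 (E (iv (lf v))) by rewrite lfK//; apply: body_mono bv; lra.
  move: (lf v) bz => z bz {v bv}; apply: contrapT => zfar.
  have far y : y \in S -> ~ body (eps / 2) (E (iv z) - E (iv y)).
    move=> yS b; apply: zfar; exists (E (iv y)) => //.
    by apply/mapP; exists y; rewrite ?mem_enum.
  have zS : z \notin S.
    apply/negP => /far; apply; rewrite subrr; apply: body0; have := eps_gt0; lra.
  have /Smax : sep (z |: S)%SET.
    apply/andP; split.
      rewrite finset.subUset Sb andbT finset.sub1set; exact/ballP.
    apply/forall_inP => x xS; apply/forall_inP => y yS; apply/implyP => xy.
    apply/negP => /asboolP b; move: xS yS xy; rewrite !finset.in_setU1.
    move=> /orP[/eqP xz|xS] /orP[/eqP yz|yS] /eqP xy.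
    + by apply: xy; rewrite xz yz.
    + by apply: (far y) => //; rewrite -xz.
    + apply: (far x) => //; rewrite -yz -opprB -scaleN1r.
      by have := body_scale (-1) b; rewrite normrN1 mul1r.
    + by apply: xy; exact: sepP.
  by rewrite /geq /= cardsU1 zS add1n ltnn.
Qed.

End Grid.

Lemma body_net (k : nat) : (0 < k)%N -> exists s : seq 'M[R]_(p, q),
  [/\ (size s <= (16 * k) ^ (p * q))%N, forall y, y \in s -> body 1 y
    & forall x, body 1 x -> exists2 y, y \in s & body k%:R^-1 (x - y)].
Proof.
move=> k0; have kR : 0 < k%:R :> R by rewrite ltr0n.
pose eps : R := k%:R^-1.
have e0 : 0 < eps by rewrite invr_gt0.
have e1 : eps <= 1 by rewrite invf_le1// ler1n.
(* Rounding to mesh [h] costs at most kappa h = eps / 4. *)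
pose h := eps / (4 * kappa).
have h0 : 0 < h by rewrite divr_gt0// mulr_gt0.
pose B := (Num.truncn (2 / h)).+1.
have hB : 2 <= h * B%:R.
  rewrite mulrC -ler_pdivrMr// ltW//; apply: truncnS_gt.
have [s [s1 s2 s3]] := grid_net k0 h0 hB; exists s; split=> // x bx.
(* Shrinking first keeps the rounded point in the unit body. The error budget is eps / 4 for
   shrinking, eps / 4 for rounding and eps / 2 for the lattice net. *)
pose x' := (1 - eps / 4) *: x.
have bx' : body (1 - eps / 4) x'.
  have := body_scale (1 - eps / 4) bx; rewrite ger0_norm ?mulr1//; lra.
pose v : 'M[int]_(p, q) := \matrix_(i, j) Num.floor (x' i j / h).
pose y := h *: map_mx intr v : 'M[R]_(p, q).
have bv : body (eps / 4) (y - x').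
  have -> : eps / 4 = kappa * h by rewrite /h; field; rewrite gt_eqF.
  apply: body_sup => [|i j]; first exact: ltW.
  rewrite !mxE -/x'; set a := _ * x i j.
  have /andP[f1 f2] := floor_itv (a / h).
  rewrite ler_pdivlMr// mulrC in f1; rewrite ltr_pdivrMr// mulrC in f2.
  rewrite intrD mulrDr mulr1 in f2.
  by rewrite ler_norml; apply/andP; split; lra.
have by1 : body 1 y.
  by rewrite -(subrK x' y); apply: body_mono (body_add bv bx'); lra.
have [u us uy] := s3 v by1; exists u => //.
have -> : x - u = (y - u) + ((-1) *: (y - x') + (x - x')).
  rewrite scaleN1r opprB (addrC y) addrACA addrA.
  by apply/matrixP=> i j; rewrite !mxE; ring.
have bxx' : body (eps / 4) (x - x').
  rewrite /x' -{1}(scale1r x) -scalerBl.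
  by have := body_scale (1 - (1 - eps / 4)) bx; rewrite ger0_norm ?mulr1 ?subKr//; lra.
have := body_scale (-1) bv; rewrite normrN1 mul1r => bv'.
apply: body_mono (body_add uy (body_add bv' bxx')); rewrite -/eps; lra.
Qed.

End Net.

(** * Low-rank matrices as a partial isometry times a matrix of the same norm *)

Section Factorization.
Context {R : realType}.

Definition op_ball p k (rho : R) (U : 'M[R]_(p, k)) :=
  forall x : 'cV[R]_k, frob_norm (U *m x) <= rho * frob_norm x.

Lemma frob_norm_delta p k (i : 'I_p) (j : 'I_k) :
  frob_norm (delta_mx i j : 'M[R]_(p, k)) = 1.
Proof.
rewrite -[RHS]sqrtr1 /frob_norm frob_dotE; congr Num.sqrt.
rewrite (bigD1 i)//= (bigD1 j)//= !mxE !eqxx mulr1 !big1 ?addr0// => a ai.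
  by rewrite big1// => b _; rewrite !mxE (negbTE ai) mul0r.
by rewrite !mxE (negbTE ai) andbF mul0r.
Qed.

Lemma frob_norm_le_sum p k (A : 'M[R]_(p, k)) :
  frob_norm A <= \sum_i \sum_j `|A i j|.
Proof.
rewrite {1}(matrix_sum_delta A); apply: (le_trans (frob_norm_sum _)).
apply: ler_sum => i _; apply: (le_trans (frob_norm_sum _)).
by apply: ler_sum => j _; rewrite frob_normZ frob_norm_delta mulr1.
Qed.

Lemma frob_norm_le_sup p k (e : R) (A : 'M[R]_(p, k)) :
  (forall i j, `|A i j| <= e) -> frob_norm A <= (p * k)%:R * e.
Proof.
move=> Ae; apply: (le_trans (frob_norm_le_sum A)).
apply: (@le_trans _ _ (\sum_(i < p) \sum_(j < k) e)).
  by do 2![apply: ler_sum => ? _].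
by rewrite !sumr_const !card_ord -mulrnA mulr_natl mulnC.
Qed.

(** [u] is the normalized [a], or 0 if [a] is 0. Asking for u u^T u = u rather than u^T u = 1 covers
    both cases: u u^T is the orthogonal projector onto the span of [a]. *)
Lemma unit_direction m (a : 'cV[R]_m) : exists u : 'cV[R]_m,
  [/\ u *m u^T *m a = a, u *m u^T *m u = u & op_ball 1 u].
Proof.
have [->|a0] := eqVneq a 0.
  exists 0; rewrite !mul0mx; split=> // x.
  by rewrite mul0mx frob_norm0 mul1r frob_norm_ge0.
have na0 : frob_norm a != 0 by rewrite frob_norm_eq0.
have ata : a^T *m a = (frob_norm a ^+ 2)%:M.
  apply/matrixP => i j; rewrite !ord1 sqr_frob_norm frob_dotE !mxE eqxx mulr1n.
  by apply: eq_bigr => l _; rewrite mxE big_ord1.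
pose u := (frob_norm a)^-1 *: a.
have uT : u^T = (frob_norm a)^-1 *: a^T by rewrite /u linearZ.
have utu : u^T *m u = 1%:M.
  rewrite uT /u -scalemxAl -scalemxAr ata !scale_scalar_mx.
  by congr (_%:M); field.
exists u; split.
- rewrite uT /u -mulmxA -!scalemxAl -scalemxAr ata mul_mx_scalar !scalerA.
  by rewrite (_ : _ * _ = 1) ?scale1r//; field.
- by rewrite -mulmxA utu mulmx1.
move=> x; rewrite mul1r -ler_sqr ?nnegrE ?frob_norm_ge0//.
by rewrite sqr_frob_norm frob_dot_mull mulmxA utu mul1mx sqr_frob_norm.
Qed.

(** Gram-Schmidt by induction on the columns: split off the direction of the first one, project the
    others onto its orthogonal complement and recurse. *)
Lemma column_space_isometry m k (A : 'M[R]_(m, k)) :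
  exists U : 'M[R]_(m, k), op_ball 1 U /\ U *m U^T *m A = A.
Proof.
elim: k A => [|k IH] A.
  exists 0; split; last by rewrite [RHS]thinmx0 thinmx0.
  by move=> x; rewrite mul0mx frob_norm0 mul1r frob_norm_ge0.
move: A; rewrite -add1n => A.
pose a := lsubmx A; pose A' := rsubmx A.
have [u [ua uu uop]] := unit_direction a.
pose P := 1%:M - u *m u^T.
have PT : P^T = P by rewrite /P linearB /= trmx1 trmx_mul trmxK.
have Pa : P *m a = 0 by rewrite /P mulmxBl mul1mx ua subrr.
have Pu : P *m u = 0 by rewrite /P mulmxBl mul1mx uu subrr.
have PP : P *m P = P by rewrite {2}/P mulmxBr mulmx1 mulmxA Pu mul0mx subr0.
have PE : u *m u^T + P = 1%:M by rewrite addrC subrK.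
have Pop q (z : 'M[R]_(m, q)) : frob_norm (P *m z) <= frob_norm z.
  rewrite -ler_sqr ?nnegrE ?frob_norm_ge0//.
  rewrite -{2}[z]mul1mx -PE mulmxDl frob_normD_sqr -mulmxA frob_dot_mull.
  have -> : u^T *m (P *m z) = 0.
    by rewrite mulmxA -[u^T *m P]trmxK trmx_mul PT trmxK Pu linear0 mul0mx.
  by rewrite frob_dot0r mulr0 addr0 lerDr sqr_ge0.
have [U [Uop UA]] := IH (P *m A').
(* [U] need not have its range orthogonal to [u]; the factor [P] enforces it, so that norms add by
   Pythagoras. *)
exists (row_mx u (P *m U)); split.
  move=> x; rewrite -(vsubmxK x) mul_row_col.
  set x0 := usubmx _; set x1 := dsubmx _.
  rewrite mul1r -ler_sqr ?nnegrE ?frob_norm_ge0// frob_normD_sqr frob_dot_mull.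
  have -> : u^T *m (P *m U *m x1) = 0.
    by rewrite !mulmxA -[u^T *m P]trmxK trmx_mul PT trmxK Pu linear0 !mul0mx.
  rewrite frob_dot0r mulr0 addr0.
  have -> : frob_norm (col_mx x0 x1) ^+ 2 = frob_norm x0 ^+ 2 + frob_norm x1 ^+ 2.
    by rewrite !sqr_frob_norm /frob_dot tr_col_mx mul_row_col mxtraceD.
  rewrite lerD// ler_sqr ?nnegrE ?frob_norm_ge0//.
    by have := uop x0; rewrite mul1r.
  rewrite -mulmxA; apply: (le_trans (Pop _ _)).
  by have := Uop x1; rewrite mul1r.
rewrite -[A in LHS](hsubmxK A) -/a -/A' tr_row_mx mul_row_col.
rewrite mul_mx_row trmx_mul PT mulmxDl ua -!mulmxA Pa !mulmx0 addr0.
rewrite mulmxDl -!mulmxA (mulmxA U) UA (mulmxA P P) PP mulmxA -mulmxDl PE mul1mx.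
exact: hsubmxK.
Qed.

(** Elimination gives some factor with [k] columns spanning those of [G]. With [U] built on it, U
    U^T G = G, hence |U^T G|^2 = <G, U U^T G> = |G|^2. *)
Lemma rank_factorization m n k (G : 'M[R]_(m, n)) : (\rank G <= k)%N ->
  exists (U : 'M[R]_(m, k)) (W : 'M[R]_(k, n)),
    [/\ G = U *m W, op_ball 1 U & frob_norm W = frob_norm G].
Proof.
move=> rG; pose A : 'M[R]_(m, k) := col_ebase G *m pid_mx (\rank G).
pose B : 'M[R]_(k, n) := pid_mx (\rank G) *m row_ebase G.
have GE : G = A *m B.
  rewrite /A /B mulmxA -[col_ebase G *m _ *m _]mulmxA mul_pid_mx minnn.
  by rewrite (minn_idPr rG) mulmx_ebase.
have [U [Uop UA]] := column_space_isometry A.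
have UG : U *m (U^T *m G) = G by rewrite mulmxA {1}GE mulmxA UA -GE.
exists U, (U^T *m G); split=> //.
by rewrite /frob_norm frob_dot_mull trmxK UG.
Qed.

End Factorization.

Section SensingTheory.
Context {R : realType} {m n d : nat} (Z : 'I_d -> 'M[R]_(m, n)).
Implicit Types A B : 'M[R]_(m, n).

Lemma senseD A B : sense Z (A + B) = sense Z A + sense Z B.
Proof. by apply/matrixP => i j; rewrite !mxE frob_dotDr. Qed.

Lemma senseZ a A : sense Z (a *: A) = a *: sense Z A.
Proof. by apply/matrixP => i j; rewrite !mxE frob_dotZr. Qed.

Lemma senseB A B : sense Z (A - B) = sense Z A - sense Z B.
Proof. by rewrite -scaleN1r senseD senseZ scaleN1r. Qed.

Lemma sense0 : sense Z 0 = 0.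
Proof. by rewrite -(scale0r 0) senseZ scale0r. Qed.

Lemma sense_sum (I : finType) (F : I -> 'M[R]_(m, n)) :
  sense Z (\sum_i F i) = \sum_i sense Z (F i).
Proof. by apply: (big_morph (sense Z) senseD sense0). Qed.

Lemma frob_dot_sense_adj (y : 'cV[R]_d) A :
  frob_dot (sense_adj Z y) A = frob_dot y (sense Z A).
Proof.
rewrite /sense_adj [RHS]frob_dotE.
rewrite (big_morph (frob_dot^~ A) (fun B C => frob_dotDl B C A) (_ : _ = 0)); last first.
  by rewrite frob_dotC frob_dot0r.
by apply: eq_bigr => i _; rewrite big_ord1 frob_dotZl mxE.
Qed.

Lemma frob_norm_sense_le A :
  frob_norm (sense Z A) <= (\sum_i frob_norm (Z i)) * frob_norm A.
Proof.
apply: (le_trans (frob_norm_le_sum _)); rewrite mulr_suml.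
by apply: ler_sum => i _; rewrite big_ord1 mxE frob_dot_abs_le.
Qed.

End SensingTheory.

(** * Nets of low-rank matrices, and restricted isometry from a net *)

Section LowRankNet.
Context {R : realType}.

Lemma frob_ball_net p q (k : nat) : (0 < k)%N -> exists s : seq 'M[R]_(p, q),
  [/\ (size s <= (16 * k) ^ (p * q))%N, forall y, y \in s -> frob_norm y <= 1
    & forall x, frob_norm x <= 1 -> exists2 y, y \in s & frob_norm (x - y) <= k%:R^-1].
Proof.
(* The successor keeps [kappa] positive when the matrices are empty. *)
move=> k0; apply: (@body_net _ _ _ (fun a x => frob_norm x <= a) (p * q).+1%:R) => //.
- by move=> a b x y xa yb; apply: le_trans (frob_normD _ _) _; exact: lerD.
- by move=> a c x xa; rewrite frob_normZ ler_wpM2l.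
- by move=> a b x ab xa; exact: le_trans ab.
- by move=> a x i j; apply: le_trans; exact: coord_le_frob_norm.
- move=> e x e0 xe; apply: (le_trans (frob_norm_le_sup xe)).
  by rewrite ler_wpM2r// ler_nat.
Qed.

Lemma op_ball_net p q (k : nat) : (0 < k)%N -> exists s : seq 'M[R]_(p, q),
  [/\ (size s <= (16 * k) ^ (p * q))%N, forall y, y \in s -> op_ball 1 y
    & forall x, op_ball 1 x -> exists2 y, y \in s & op_ball k%:R^-1 (x - y)].
Proof.
move=> k0; apply: (@body_net _ _ _ (@op_ball R p q) (p * q).+1%:R) => //.
- move=> a b x y xa yb z; rewrite mulmxDl mulrDl.
  by apply: le_trans (frob_normD _ _) _; exact: lerD.
- by move=> a c x xa z; rewrite -scalemxAl frob_normZ -mulrA ler_wpM2l.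
- move=> a b x ab xa z; apply: le_trans (xa z) _.
  by rewrite ler_wpM2r// frob_norm_ge0.
- move=> a x i j /(_ (delta_mx j 0)); rewrite frob_norm_delta mulr1.
  apply: le_trans; rewrite -colE.
  by apply: le_trans (coord_le_frob_norm _ i 0); rewrite mxE.
- move=> e x e0 xe z; apply: (@le_trans _ _ (\sum_i \sum_j e * frob_norm z)).
    apply: (le_trans (frob_norm_le_sum _)); apply: ler_sum => i _.
    rewrite big_ord1 mxE; apply: (le_trans (ler_norm_sum _ _ _)).
    apply: ler_sum => j _; rewrite normrM ler_pM// coord_le_frob_norm//.
  rewrite !sumr_const !card_ord -mulrnA -[leLHS]mulr_natl -mulrA mulnC.
  by rewrite ler_wpM2r ?mulr_ge0 ?frob_norm_ge0// ler_nat.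
Qed.

(* The net is made of products of a net for the left isometric factor (in
   operator norm) and one for the right factor (in Frobenius norm).  Replacing
   one factor at a time leaves two errors that again have rank at most [k]. *)
Lemma low_rank_net m n k q : (0 < q)%N -> exists s : seq 'M[R]_(m, n),
  [/\ (size s <= (16 * q) ^ (k * (m + n)))%N,
      forall H, H \in s -> frob_norm H <= 1
    & forall G, (\rank G <= k)%N -> frob_norm G <= 1 ->
      exists (H D1 D2 : 'M[R]_(m, n)),
        [/\ H \in s, G = H + (D1 + D2),
            (\rank D1 <= k)%N /\ frob_norm D1 <= q%:R^-1
          & (\rank D2 <= k)%N /\ frob_norm D2 <= q%:R^-1]].
Proof.
move=> q0; have qR : 0 <= q%:R^-1 :> R by rewrite invr_ge0.
have [sU [sU1 sU2 sU3]] := @op_ball_net m k q q0.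
have [sW [sW1 sW2 sW3]] := @frob_ball_net k n q q0.
exists [seq U *m W | U <- sU, W <- sW]; split.
- by rewrite size_allpairs mulnDr expnD (mulnC k m) leq_mul.
- move=> _ /allpairsP[[U W] /= [/sU2 Uop /sW2 W1 ->]].
  by apply: le_trans W1; have := frob_norm_mul_op W ler01 Uop; rewrite mul1r.
move=> G rG G1; have [U [W [GE Uop WG]]] := rank_factorization rG.
have [U' U's UU'] := sU3 _ Uop.
have [W' W's WW'] : exists2 y, y \in sW & frob_norm (W - y) <= q%:R^-1.
  by apply: sW3; rewrite WG.
exists (U' *m W'), ((U - U') *m W), (U' *m (W - W')); split.
- by apply/allpairsP; exists (U', W').
- by rewrite mulmxBl mulmxBr GE; apply/matrixP => i j; rewrite !mxE; ring.
- split; first exact: mulmx_max_rank.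
  apply: (le_trans (frob_norm_mul_op W qR UU')).
  by rewrite ler_piMr// WG.
- split; first exact: mulmx_max_rank.
  apply: le_trans WW'; have := frob_norm_mul_op (W - W') ler01 (sU2 _ U's).
  by rewrite mul1r.
Qed.

(** Let [M] be the supremum of |Z(G)| over the low-rank unit ball. Since [D1] and [D2] are again of
    rank at most [k], each costs at most M / 100, and the resulting inequality for [M] can be solved
    because [M] is finite. *)
Lemma rip_of_net m n k d (s : seq 'M[R]_(m, n)) (Z : 'I_d -> 'M[R]_(m, n)) :
  (forall H, H \in s -> frob_norm H <= 1) ->
  (forall G, (\rank G <= k)%N -> frob_norm G <= 1 ->
      exists (H D1 D2 : 'M[R]_(m, n)),
        [/\ H \in s, G = H + (D1 + D2),
            (\rank D1 <= k)%N /\ frob_norm D1 <= 100%:R^-1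
          & (\rank D2 <= k)%N /\ frob_norm D2 <= 100%:R^-1]) ->
  (forall H, H \in s ->
     (1 - 100%:R^-1) * frob_norm H ^+ 2 <= frob_norm (sense Z H) ^+ 2
       <= (1 + 100%:R^-1) * frob_norm H ^+ 2) ->
  rip_bounds Z k 9^-1.
Proof.
move=> s1 snet sZ.
pose S := [set frob_norm (sense Z G) |
  G in [set G : 'M[R]_(m, n) | (\rank G <= k)%N /\ frob_norm G <= 1]].
have S0 : S !=set0.
  exists 0, 0; last by rewrite sense0 frob_norm0.
  by rewrite /= mxrank0 frob_norm0.
have Sub : has_ubound S.
  exists (\sum_i frob_norm (Z i)) => _ [G [_ G1] <-].
  apply: (le_trans (frob_norm_sense_le _ _)); rewrite ler_piMr//.
  by apply: sumr_ge0 => i _; exact: frob_norm_ge0.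
pose M := sup S.
have SM G : (\rank G <= k)%N -> frob_norm G <= 1 -> frob_norm (sense Z G) <= M.
  by move=> rG G1; apply: ub_le_sup => //; exists G.
have M0 : 0 <= M.
  by apply: le_trans (SM 0 _ _); rewrite ?frob_norm_ge0 ?mxrank0 ?frob_norm0.
have SMD D : (\rank D <= k)%N -> frob_norm D <= 100%:R^-1 ->
    frob_norm (sense Z D) <= M / 100.
  move=> rD D1; rewrite ler_pdivlMr// mulrC -[100]gtr0_norm// -frob_normZ -senseZ.
  apply: SM; first exact: leq_trans (mxrank_scale _ _) rD.
  by rewrite frob_normZ gtr0_norm// -ler_pdivlMl// mulr1.
have split2 H D1 D2 : sense Z (H + (D1 + D2)) = sense Z H + (sense Z D1 + sense Z D2).
  by rewrite !senseD.
have M1 : M <= (641 / 625).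
  (* 201/200 bounds the square root of 1 + 1/100. Solving gives M <= 201/196, below 641/625. *)
  have : M <= (201 / 200) + M / 50.
    apply: ge_sup => // _ [G [rG G1] <-].
    have [H [D1 [D2 [Hs -> [r1 n1] [r2 n2]]]]] := snet G rG G1.
    have /andP[_ HU] := sZ H Hs; have H1 := s1 H Hs; have H0 := frob_norm_ge0 H.
    rewrite split2; apply: (le_trans (frob_normD _ _)).
    have := frob_normD (sense Z D1) (sense Z D2).
    have := SMD _ r1 n1; have := SMD _ r2 n2.
    have : frob_norm (sense Z H) <= (201 / 200).
      rewrite -ler_sqr ?nnegrE ?frob_norm_ge0//.
      have H2 : frob_norm H ^+ 2 <= 1 by rewrite expr_le1.
      by apply: (le_trans HU); lra.
    lra.
  lra.
(* The net point has norm at least 1 - 2/100, so its image has norm at least 39/40; subtracting 2 M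
   / 100 leaves 1193/1250. *)
have key G : (\rank G <= k)%N -> frob_norm G = 1 ->
    (1193 / 1250) <= frob_norm (sense Z G) <= (641 / 625).
  move=> rG G1; rewrite (le_trans (SM _ rG _) M1) ?G1// andbT.
  have nG : frob_norm G <= 1 by rewrite G1.
  have [H [D1 [D2 [Hs GE [r1 n1] [r2 n2]]]]] := snet G rG nG.
  have /andP[HL _] := sZ H Hs; have H0 := frob_norm_ge0 H.
  have : frob_norm G <= frob_norm H + (frob_norm D1 + frob_norm D2).
    rewrite GE; apply: (le_trans (frob_normD _ _)); rewrite lerD2l; exact: frob_normD.
  have : frob_norm (sense Z H) <= frob_norm (sense Z G) +
      (frob_norm (sense Z D1) + frob_norm (sense Z D2)).
    have -> : sense Z H = sense Z G - (sense Z D1 + sense Z D2) by rewrite GE split2 addrK.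
    apply: (le_trans (frob_normB _ _)); rewrite lerD2l; exact: frob_normD.
  have := SMD _ r1 n1; have := SMD _ r2 n2 => h1 h2 h3; rewrite G1 => h4.
  have hH : (49 / 50) <= frob_norm H by lra.
  have : (39 / 40) <= frob_norm (sense Z H).
    rewrite -ler_sqr ?nnegrE ?frob_norm_ge0//.
    have H2 : (49 / 50) ^+ 2 <= frob_norm H ^+ 2.
      by rewrite ler_sqr ?nnegrE//; lra.
    by apply: (le_trans _ HL); lra.
  lra.
split; first by apply/andP; split; lra.
move=> G rG; have [->|G0] := eqVneq G 0.
  by rewrite sense0 !frob_norm0 expr0n/= !mulr0 lexx.
have [c [G' [c0 -> G'1 rG']]] : exists c (G' : 'M[R]_(m, n)),
    [/\ 0 < c, G = c *: G', frob_norm G' = 1 & (\rank G' <= k)%N].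
  have g0 : 0 < frob_norm G by rewrite frob_norm_gt0.
  exists (frob_norm G), ((frob_norm G)^-1 *: G); split=> //.
  - by rewrite scalerA divff ?scale1r// gt_eqF.
  - by rewrite frob_normZ ger0_norm ?invr_ge0 ?ltW// mulVf// gt_eqF.
  - by exact: leq_trans (mxrank_scale _ _) rG.
rewrite senseZ !frob_normZ G'1 mulr1 !exprMn.
have /andP[k1 k2] := key G' rG' G'1.
have g2 : 0 < `|c| ^+ 2 by rewrite exprn_gt0// gtr0_norm.
set x := frob_norm (sense Z G') in k1 k2 *; set y := _ ^+ 2 in g2 *.
have : 8 / 9 <= x ^+ 2 <= 10 / 9 by apply/andP; split; nra.
move=> /andP[x1 x2]; apply/andP; split; nra.
Qed.

End LowRankNet.

(** * Restricted isometry with high probability *)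

Section RandomRip.
Context {R : realType} {dT : measure_display} {T : measurableType dT}.
Context (P : probability T R).

Lemma union_bound (I : eqType) (s : seq I) (F : I -> set T) (b : R) :
  (forall i, measurable (F i)) -> (forall i, (P (~` F i) <= b%:E)%E) ->
  exists E, [/\ measurable E, (P (~` E) <= ((size s)%:R * b)%:E)%E
    & forall w, E w -> forall i, i \in s -> F i w].
Proof.
move=> mF PF; elim: s => [|a s [E [mE PE EF]]].
  by exists setT; split=> //; rewrite setCT measure0 mul0r.
exists (F a `&` E); split.
- exact: measurableI.
- rewrite setCI.
  have mF' : measurable (~` F a) by exact: measurableC.
  have mE' : measurable (~` E) by exact: measurableC.
  have := @measureU2 _ _ _ P _ _ mF' mE'; move=> /le_trans; apply.
  by rewrite /= -natr1 mulrDl mul1r addrC EFinD leeD.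
- by move=> w [Fw Ew] i; rewrite inE => /orP[/eqP ->//|]; exact: EF.
Qed.

Context (m n d : nat) (Z : 'I_d -> 'I_m -> 'I_n -> {RV P >-> R}).
Hypothesis gaussZ : iid_gaussian_entries Z.
Hypothesis d_gt0 : (0 < d)%N.

Lemma frob_norm_sense_random w (H : 'M[R]_(m, n)) :
  frob_norm (sense (random_sensing Z w) H) ^+ 2 = \sum_i gform Z H i w ^+ 2.
Proof.
rewrite sqr_frob_norm frob_dotE; apply: eq_bigr => i _.
by rewrite big_ord1 !mxE -expr2.
Qed.

Definition near_isometry_event (e : R) (H : 'M[R]_(m, n)) : set T :=
  [set w | (1 - e) * frob_norm H ^+ 2 <=
    frob_norm (sense (random_sensing Z w) H) ^+ 2 <= (1 + e) * frob_norm H ^+ 2].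

Lemma measurable_near_isometry_event e H : measurable (near_isometry_event e H).
Proof.
pose S w := \sum_i gform Z H i w ^+ 2.
have mS : measurable_fun [set: T] S.
  by apply: measurable_sum => i; apply: measurable_funX; exact: measurable_gform.
rewrite (_ : near_isometry_event e H =
  [set w | (1 - e) * frob_norm H ^+ 2 <= S w] `&`
  [set w | S w <= (1 + e) * frob_norm H ^+ 2]).
  by apply: measurableI; rewrite -[X in measurable X]setTI; apply: measurable_fun_le.
apply/seteqP; split=> w; rewrite /near_isometry_event /= frob_norm_sense_random.
  by move=> /andP.
by move=> [h1 h2]; apply/andP.
Qed.

Lemma near_isometry_event_prob (e : R) H : 0 < e -> e <= 1 ->
  (P (~` near_isometry_event e H) <= (2 * expR (- (d%:R * e ^+ 2 / 64)))%:E)%E.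
Proof.
move=> e0 e1; have [H0|H0] := eqVneq H 0.
  rewrite (_ : ~` _ = set0) ?measure0 ?lee_fin ?mulr_ge0 ?expR_ge0//.
  apply/seteqP; split=> // w; apply; rewrite /near_isometry_event /= H0.
  by rewrite sense0 !frob_norm0 expr0n/= !mulr0 lexx.
have h0 : 0 < frob_norm H by rewrite frob_norm_gt0.
pose G := (frob_norm H)^-1 *: H.
have G1 : frob_norm G = 1.
  by rewrite frob_normZ ger0_norm ?invr_ge0 ?ltW// mulVf// gt_eqF.
pose S w := \sum_i gform Z G i w ^+ 2.
have mS : measurable_fun [set: T] S.
  by apply: measurable_sum => i; apply: measurable_funX; exact: measurable_gform.
pose U := [set w | 1 + e <= S w]; pose V := [set w | S w <= 1 - e].
have mU : measurable U by rewrite -[X in measurable X]setTI; apply: measurable_fun_le.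
have mV : measurable V by rewrite -[X in measurable X]setTI; apply: measurable_fun_le.
apply: (@le_trans _ _ (P (U `|` V))).
  apply: le_measure; rewrite ?inE.
  - apply: measurableC; exact: measurable_near_isometry_event.
  - exact: measurableU.
  move=> w /= nw; apply: contrapT => /not_orP[/negP nU /negP nV]; apply: nw.
  rewrite /near_isometry_event /=.
  have -> : frob_norm (sense (random_sensing Z w) H) ^+ 2 = S w * frob_norm H ^+ 2.
    rewrite /S -frob_norm_sense_random senseZ frob_normZ ger0_norm ?invr_ge0 ?ltW//.
    by rewrite exprMn mulrAC -exprMn mulVf ?gt_eqF// expr1n mul1r.
  by move: nU nV; rewrite -!ltNge => /ltW nU /ltW nV; rewrite !ler_pM2r ?exprn_gt0// nV.
apply: (le_trans (measureU2 _ mU mV)); rewrite mulr2n mulrDl mul1r EFinD.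
by apply: leeD; [exact: upper_tail|exact: lower_tail].
Qed.

End RandomRip.

(** Absorbs the factor 2 of the two-sided tail into the base of the net size. *)
Lemma natr_le_expR_ln (R : realType) (b N s : nat) : (0 < b)%N -> (0 < N)%N ->
  (s <= b ^ N)%N -> s%:R * 2 <= expR (N%:R * ln ((2 * b)%:R : R)).
Proof.
move=> b0 N0 sb; rewrite expRM_natl lnK ?posrE ?ltr0n ?muln_gt0// -natrX -natrM.
rewrite ler_nat mulnC expnMn leq_mul// -{1}(expn1 2) leq_exp2l//.
Qed.

Lemma gaussian_rip (R : realType) : exists (c0 : nat) (c1 : R),
  [/\ (0 < c0)%N, 0 < c1 & forall (m n k d : nat) (dT : measure_display)
    (T : measurableType dT) (P : probability T R)
    (Z : 'I_d -> 'I_m -> 'I_n -> {RV P >-> R}),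
    (0 < k * (m + n))%N -> d = (c0 * (k * (m + n)))%N -> iid_gaussian_entries Z ->
    exists E : set T, [/\ measurable E, ((1 - expR (- (c1 * d%:R)))%:E <= P E)%E
      & forall w, E w -> rip_bounds (random_sensing Z w) k 9^-1]].
Proof.
have [b b0 bE] : exists2 b, (0 < b)%N & (16 * 100)%N = b by exists (16 * 100)%N.
pose a : R := 100%:R^-1 ^+ 2 / 64.
have a0 : 0 < a by rewrite divr_gt0// exprn_gt0.
(* Each net point fails with probability at most 2 exp(- a d). This [c0] makes half of the exponent
   a d pay for the whole net, which leaves [c1] = a / 2. *)
pose c0 := (Num.truncn (2 * ln ((2 * b)%:R : R) / a)).+1.
have c0a : 2 * ln ((2 * b)%:R : R) <= a * c0%:R.
  by rewrite [leRHS]mulrC -ler_pdivrMr// ltW//; apply: truncnS_gt.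
exists c0, (a / 2); split=> //; first by rewrite divr_gt0.
move=> m n k d dT T P Z N0 dE gaussZ; set N := (k * (m + n))%N in N0 dE.
have d0 : (0 < d)%N by rewrite dE muln_gt0.
have [s [s1 s2 s3]] := @low_rank_net R m n k 100 isT.
have e0 : 0 < 100%:R^-1 :> R by lra.
have e1 : 100%:R^-1 <= 1 :> R by lra.
have [E [mE PE Es]] := union_bound s
  (fun H => measurable_near_isometry_event Z (100%:R^-1) H)
  (fun H => near_isometry_event_prob gaussZ d0 H e0 e1).
exists E; split=> //; last by move=> w Ew; apply: rip_of_net s2 s3 _ => H; exact: Es.
have -> : P E = (1 - P (~` E))%E.
  by rewrite -[in LHS](setCK E) probability_setC//; exact: measurableC.
rewrite EFinB leeB//; apply: (le_trans PE); rewrite lee_fin.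
have dR : d%:R = c0%:R * N%:R :> R by rewrite dE natrM.
have -> : - (a / 2 * d%:R) = a / 2 * d%:R + - (d%:R * 100%:R^-1 ^+ 2 / 64).
  by rewrite /a; field.
rewrite expRD [leLHS]mulrA ler_pM2r ?expR_gt0//.
have ln0 : 0 <= ln ((2 * b)%:R : R) by rewrite ln_ge0// ler1n muln_gt0.
apply: (@le_trans _ _ (expR (N%:R * ln ((2 * b)%:R : R)))); last first.
  rewrite ler_expR dR; have := ler_wpM2l (ler0n R N) c0a; lra.
by apply: natr_le_expR_ln => //; rewrite -bE.
Qed.

(** * Iterative hard thresholding and descent *)

Section Descent.
Context {R : realType} {m n : nat}.
Variables (f : 'M[R]_(m, n) -> R) (L : R).
Hypotheses (df : forall X, differentiable f X) (smoothf : smooth L f).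

Lemma is_derive_line X D (s : R) :
  is_derive s (1 : R) (fun s => f (X + s *: D))
    (frob_dot (grad f (X + s *: D)) D).
Proof.
rewrite (frob_dot_grad D (df _)) -deriveE//.
have E : (fun h : R => h^-1 *: (f (X + (h *: (1 : R) + s) *: D) - f (X + s *: D))) =
         (fun h : R => h^-1 *: (f (h *: D + (X + s *: D)) - f (X + s *: D))).
  by apply/funext => h; rewrite [h *: 1]mulr1 scalerDl addrCA.
apply: DeriveDef; last by rewrite /derive /= E.
by rewrite /derivable /= E; exact: diff_derivable.
Qed.

Lemma smooth_upper_bound X Y :
  f Y <= f X + frob_dot (grad f X) (Y - X) + L / 2 * frob_norm (Y - X) ^+ 2.
Proof.
pose D := Y - X; rewrite -/D; have -> : Y = X + D by rewrite addrC subrK.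
set g := grad f X.
(* The quadratic model minus [f] along the segment from X to Y, up to the constant f(X). The
   Lipschitz bound on the gradient makes its derivative nonnegative for s > 0. *)
pose psi (s : R) := s * frob_dot g D + s ^+ 2 * (L / 2 * frob_norm D ^+ 2)
  - f (X + s *: D).
pose dpsi (s : R) := frob_dot g D + s * (L * frob_norm D ^+ 2)
  - frob_dot (grad f (X + s *: D)) D.
have : psi 0 <= psi 1.
  apply: (@ge0_is_derive_le _ psi dpsi); last exact: ler01.
    move=> s; have h := is_derive_line X D s.
    by apply: is_derive_eq; rewrite /dpsi /= ?scaler1 /GRing.scale /=; field.
  move=> s s0 _; rewrite /dpsi.
  have : frob_dot (grad f (X + s *: D) - g) D <= s * (L * frob_norm D ^+ 2).
    apply: (le_trans (frob_dot_le _ _)).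
    have := smoothf (X + s *: D) X.
    rewrite addrAC subrr add0r frob_normZ gtr0_norm// -/g => h.
    have := ler_wpM2r (frob_norm_ge0 D) h; lra.
  rewrite frob_dotDl frob_dotNl; lra.
rewrite /psi scale0r scale1r addr0; lra.
Qed.

(** Completing the square: - <g, G> / L + |G|^2 / (2 L) = (|g - G|^2 - |g|^2) / (2 L), where g is
    the gradient at X. *)
Lemma gradient_step_decrease X G : 0 < L ->
  f (X - L^-1 *: G) <= f X - frob_norm (grad f X) ^+ 2 / (2 * L)
    + frob_norm (grad f X - G) ^+ 2 / (2 * L).
Proof.
move=> L0; have := smooth_upper_bound X (X - L^-1 *: G).
have -> : X - L^-1 *: G - X = - L^-1 *: G by rewrite addrAC subrr add0r scaleNr.
rewrite frob_dotZr frob_normZ normrN gtr0_norm ?invr_gt0//.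
rewrite frob_normB_sqr => /le_trans; apply; rewrite le_eqVlt; apply/orP; left.
by apply/eqP; field; rewrite gt_eqF.
Qed.

End Descent.

Section RipConst.
Context {R : realType} {m n d : nat} (Z : 'I_d -> 'M[R]_(m, n)) (k : nat) (b : R).
Hypothesis ripb : rip_bounds Z k b.

Lemma rip_const_ge0 : 0 <= rip_const Z k.
Proof.
by apply: lb_le_inf; [exists b|move=> x [/andP[/ltW]]].
Qed.

Lemma rip_const_le : rip_const Z k <= b.
Proof. by apply: ge_inf => //; exists 0 => x [/andP[/ltW]]. Qed.

(* Unlike [rip_const_min], this covers the value 0. *)
Lemma rip_constP G : (\rank G <= k)%N ->
  (1 - rip_const Z k) * frob_norm G ^+ 2 <= frob_norm (sense Z G) ^+ 2
    <= (1 + rip_const Z k) * frob_norm G ^+ 2.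
Proof.
move=> rG; set N := frob_norm G ^+ 2; set S := _ ^+ 2.
have N0 : 0 <= N by exact: sqr_ge0.
have hlb : has_lbound (rip_bounds Z k) by exists 0 => x [/andP[/ltW]].
have near e : 0 < e -> (1 - rip_const Z k) * N - e <= S <= (1 + rip_const Z k) * N + e.
  move=> e0; have e'0 : 0 < e / (N + 1) by rewrite divr_gt0// ltr_wpDl.
  have [x [_ /(_ G rG)/andP[x1 x2]] xe] :=
    inf_adherent e'0 (conj (ex_intro _ b ripb) hlb).
  have eN : e / (N + 1) * N <= e.
    by rewrite mulrAC ler_pdivrMr ?ltr_wpDl// ler_wpM2l ?(ltW e0)// lerDl.
  rewrite -/(rip_const Z k) in xe.
  have := ler_wpM2r N0 (ltW xe); rewrite mulrDl => h.
  move: x1 x2; rewrite -/N -/S => x1 x2.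
  by apply/andP; split; lra.
apply/andP; split; apply/ler_addgt0Pr => e /near /andP[]; lra.
Qed.

End RipConst.

(** * Sensing a matrix of arbitrary rank through blocks of [r] rows *)

Section RowBlocks.
Context {R : realType} {m n : nat} (r : nat).
Hypothesis r_gt0 : (0 < r)%N.

Definition row_block (A : 'M[R]_(m, n)) (j : nat) : 'M[R]_(m, n) :=
  \matrix_(a, b) if (a %/ r == j)%N then A a b else 0.

Lemma rank_row_block A j : (\rank (row_block A j) <= r)%N.
Proof.
(* Column [l] is the basis vector of row j r + l, or 0 past the last row; P P^T keeps the rows of
   the block. *)
pose P : 'M[R]_(m, r) := \matrix_(a, l) (a == j * r + l :> nat)%N%:R.
have -> : row_block A j = P *m (P^T *m A); last exact: mulmx_max_rank.
apply/matrixP => a b; rewrite !mxE.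
have [ja|ja] := eqVneq (a %/ r)%N j.
  have arP : (a %% r < r)%N by rewrite ltn_mod.
  have aE : (a = j * r + a %% r :> nat)%N by rewrite -ja -divn_eq.
  rewrite (bigD1 (Ordinal arP))//= mxE -aE eqxx mul1r mxE.
  rewrite (bigD1 a)//= !mxE -aE eqxx mul1r.
  rewrite !big1 ?addr0// => [l lr|a' a'a].
    rewrite !mxE (_ : (_ == _)%N = false) ?mul0r//.
    apply/negbTE/eqP => h; move/eqP: lr; apply; apply: val_inj => /=; lia.
  by rewrite !mxE -aE (_ : (_ == _)%N = false) ?mul0r//; apply/negbTE.
rewrite big1// => l _; rewrite mxE (_ : (_ == _)%N = false) ?mul0r//.
apply/negbTE/eqP => h; move/eqP: ja; apply.
by rewrite h divnMDl// divn_small// addn0.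
Qed.

Lemma sum_row_block A : \sum_(j < (m %/ r).+1) row_block A j = A.
Proof.
apply/matrixP => a b; rewrite summxE.
(* The extra block holds the incomplete last rows; it is empty when [r] divides [m]. *)
have ar : (a %/ r < (m %/ r).+1)%N by rewrite ltnS leq_div2r// ltnW.
rewrite (bigD1 (Ordinal ar))//= mxE eqxx big1 ?addr0// => j jr.
by rewrite mxE; case: eqP => // h; move/eqP: jr; case; apply: val_inj.
Qed.

Lemma frob_norm_row_block A :
  \sum_(j < (m %/ r).+1) frob_norm (row_block A j) ^+ 2 = frob_norm A ^+ 2.
Proof.
rewrite [RHS]sqr_frob_norm -[in X in _ = frob_dot _ X](sum_row_block A).
transitivity (\sum_(j < (m %/ r).+1) frob_dot A (row_block A j)).
  apply: eq_bigr => j _; rewrite sqr_frob_norm !frob_dotE.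
  apply: eq_bigr => a _; apply: eq_bigr => b _; rewrite !mxE.
  by case: ifP; rewrite ?mulr0.
elim/big_ind2 : _ => //; first by rewrite frob_dot0r.
by move=> x B y C -> ->; rewrite frob_dotDr.
Qed.

(* Blocks of [r] rows have rank at most [r], so that no singular value
   decomposition is needed. *)
Lemma sense_full_rank d (Z : 'I_d -> 'M[R]_(m, n)) (c : R) A :
  (r <= m)%N -> 0 <= c ->
  (forall G : 'M[R]_(m, n), (\rank G <= r)%N ->
     frob_norm (sense Z G) ^+ 2 <= c * frob_norm G ^+ 2) ->
  frob_norm (sense Z A) ^+ 2 <= 2 * (m%:R / r%:R) * c * frob_norm A ^+ 2.
Proof.
move=> rm c0 Zc; rewrite -{1}(sum_row_block A) sense_sum.
apply: (le_trans (frob_norm_sum_sqr _)).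
rewrite -(frob_norm_row_block A) -mulrA.
have rR : 0 < r%:R :> R by rewrite ltr0n.
apply: ler_pM.
- by [].
- by apply: sumr_ge0 => j _; exact: sqr_ge0.
(* There are m %/ r + 1 blocks, at most 2 m / r because r <= m. *)
- rewrite mulrA ler_pdivlMr// -natrM -natrM ler_nat.
  have := leq_trunc_div m r; lia.
- by rewrite mulr_sumr; apply: ler_sum => j _; apply: Zc; exact: rank_row_block.
Qed.

End RowBlocks.

(** With D1 = H' - H, D2 = B - H and v the residual at H: [a], [b] are |D1|^2, |D2|^2; [q], [p] are
    <v, Z D1>, <v, Z D2>; [S], [S'] are |Z D1|^2, |Z D2|^2; [w] is |v|^2. The loss in passing from
    (1 + c) b to S' is 2 c b <= S' / 4, which u3, the first bound on [S'], controls by the residuals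
    at B and H. *)
Lemma iht_step_arith (R : realType) (c a b p q S S' w : R) :
  0 <= c -> c <= 9^-1 -> 0 <= b ->
  S' <= 2 * (w + 2 * p + S') + 2 * w ->
  S <= (1 + c) * a -> (1 - c) * b <= S' ->
  a + 2 * ((1 + c)^-1 * q) <= b + 2 * ((1 + c)^-1 * p) ->
  w + 2 * q + S <= 3 / 2 * (w + 2 * p + S') + w / 2.
Proof.
move=> c0 c9 b0 u3 u1 u2 hproj.
have c1 : 0 < 1 + c by lra.
have h : (1 + c) * a + 2 * q <= (1 + c) * b + 2 * p.
  have := ler_wpM2l (ltW c1) hproj.
  by rewrite !mulrDr !(mulrCA (1 + c) 2) !mulVKf ?gt_eqF.
have cb : c * b <= 9^-1 * b by rewrite ler_wpM2r.
lra.
Qed.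

(** * Contraction of the thresholding iteration and its output error *)

Section HardThresholding.
Context {R : realType} {m n d : nat} (Z : 'I_d -> 'M[R]_(m, n)) (r : nat) (c : R).
Hypotheses (c_ge0 : 0 <= c) (c_le : c <= 9^-1).
Hypothesis ripc : forall G : 'M[R]_(m, n), (\rank G <= 2 * r)%N ->
  (1 - c) * frob_norm G ^+ 2 <= frob_norm (sense Z G) ^+ 2
    <= (1 + c) * frob_norm G ^+ 2.

Lemma mxrankB_le (A B : 'M[R]_(m, n)) :
  (\rank A <= r)%N -> (\rank B <= r)%N -> (\rank (A - B)%R <= 2 * r)%N.
Proof.
move=> rA rB; rewrite (leq_trans (mxrank_add _ _))//.
by rewrite mxrank_opp mul2n -addnn leq_add.
Qed.

(** [H'] is at least as close as [B] to the gradient step. With step size 1 / (1 + c) this compares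
    quadratic models of the residual, exact up to restricted isometry on H' - H and B - H, of rank
    at most 2 r. *)
Lemma iht_step (y : 'cV[R]_d) (B H H' : 'M[R]_(m, n)) :
  (\rank B <= r)%N -> (\rank H <= r)%N ->
  is_proj r (H - (1 + c)^-1 *: sense_adj Z (sense Z H - y)) H' ->
  frob_norm (sense Z H' - y) ^+ 2 <=
    3 / 2 * frob_norm (sense Z B - y) ^+ 2 + frob_norm (sense Z H - y) ^+ 2 / 2.
Proof.
move=> rB rH [rH' /(_ B rB)].
set v := sense Z H - y; pose A := sense_adj Z v; rewrite -/A.
have -> : H - (1 + c)^-1 *: A - H' = - ((H' - H) + (1 + c)^-1 *: A).
  by rewrite opprD opprB addrAC.
have -> : H - (1 + c)^-1 *: A - B = - ((B - H) + (1 + c)^-1 *: A).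
  by rewrite opprD opprB addrAC.
have dec X : sense Z X - y = v + sense Z (X - H).
  by rewrite senseB /v; apply/matrixP => i j; rewrite !mxE; ring.
have /andP[_ u1] := ripc (mxrankB_le rH' rH).
have /andP[u2 _] := ripc (mxrankB_le rB rH).
rewrite !frob_normN !dec {}/A; clearbody v; move: (H' - H) (B - H) u1 u2 => D1 D2 u1 u2.
move=> hproj; have {hproj} : frob_norm (D1 + (1 + c)^-1 *: sense_adj Z v) ^+ 2 <=
    frob_norm (D2 + (1 + c)^-1 *: sense_adj Z v) ^+ 2.
  by rewrite ler_sqr ?nnegrE ?frob_norm_ge0.
rewrite !frob_normD_sqr lerD2r !frob_dotZr !(frob_dotC _ (sense_adj _ _)).
rewrite !frob_dot_sense_adj.
have u3 : frob_norm (sense Z D2) ^+ 2 <=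
    2 * frob_norm (v + sense Z D2) ^+ 2 + 2 * frob_norm v ^+ 2.
  by have := frob_normB_sqr_le (v + sense Z D2) v; rewrite addrAC subrr add0r.
move: u3 u1 u2; rewrite frob_normD_sqr => u3 u1 u2 hproj.
exact: iht_step_arith c_ge0 c_le (sqr_ge0 _) u3 u1 u2 hproj.
Qed.

(** Iterates [iht_step]; 3 Phi* is the fixed point of Phi -> Phi / 2 + 3/2 Phi*. *)
Lemma iht_residual (y : 'cV[R]_d) (B : 'M[R]_(m, n)) t (H : nat -> 'M[R]_(m, n)) :
  (\rank B <= r)%N -> H 0%N = 0 ->
  (forall s, (s < t)%N ->
    is_proj r (H s - (1 + c)^-1 *: sense_adj Z (sense Z (H s) - y)) (H s.+1)) ->
  (\rank (H t) <= r)%N /\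
  frob_norm (sense Z (H t) - y) ^+ 2 <=
    frob_norm y ^+ 2 / 2 ^+ t + 3 * frob_norm (sense Z B - y) ^+ 2.
Proof.
move=> rB H0; elim: t => [|t IH] Hs.
  rewrite H0 mxrank0 sense0 sub0r frob_normN expr0 divr1; split=> //.
  by rewrite lerDl mulr_ge0// sqr_ge0.
have [rH h] := IH (fun s st => Hs s (ltnW st)).
have proj := Hs t (ltnSn t); split; first by case: proj.
have := iht_step rB rH proj.
have -> : frob_norm y ^+ 2 / 2 ^+ t.+1 = frob_norm y ^+ 2 / 2 ^+ t / 2.
  by rewrite (exprSr 2 t) invfM mulrA.
lra.
Qed.

Lemma low_rank_coercive (A B : 'M[R]_(m, n)) (y : 'cV[R]_d) :
  (\rank A <= r)%N -> (\rank B <= r)%N ->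
  frob_norm (A - B) ^+ 2 <=
    9 / 4 * (frob_norm (sense Z A - y) ^+ 2 + frob_norm (sense Z B - y) ^+ 2).
Proof.
move=> rA rB; have /andP[h _] := ripc (mxrankB_le rA rB).
have := frob_normB_sqr_le (sense Z A - y) (sense Z B - y).
have -> : sense Z A - y - (sense Z B - y) = sense Z (A - B).
  by rewrite senseB opprB addrA subrK.
set N := frob_norm (A - B) ^+ 2 in h *.
have N0 : 0 <= N by exact: sqr_ge0.
have cN : c * N <= 9^-1 * N by rewrite ler_wpM2r.
lra.
Qed.

Lemma iht_gradient_error (delta : R) (g G : 'M[R]_(m, n)) t :
  (0 < r)%N -> (r <= m)%N -> 0 < delta -> approx_low_rank delta r g ->
  inner_iterations_ok 1 (ln 2)^-1 delta r g (sense Z g) t ->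
  iht_output Z (sense Z g) r (1 + c)^-1 t G ->
  frob_norm (g - G) ^+ 2 <= delta ^+ 2 * C_IHT 10 m r * frob_norm g ^+ 2.
Proof.
move=> r0 rm d0 [B [rB _] gB] ok [H [H0 Hs HG]].
set y := sense Z g in ok Hs.
have [rH] := iht_residual rB H0 Hs; rewrite HG in rH *.
have rR : 0 < r%:R :> R by rewrite ltr0n.
have [ka kaE] : exists ka : R, ka = m%:R / r%:R by exists (m%:R / r%:R).
have ka1 : 1 <= ka by rewrite kaE ler_pdivlMr// mul1r ler_nat.
have [g2 g2E] : exists g2 : R, g2 = delta ^+ 2 * frob_norm g ^+ 2.
  by exists (delta ^+ 2 * frob_norm g ^+ 2).
have g20 : 0 <= g2 by rewrite g2E mulr_ge0// sqr_ge0.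
have gB2 : frob_norm (g - B) ^+ 2 <= g2.
  rewrite g2E -exprMn ler_sqr ?nnegrE ?frob_norm_ge0// mulr_ge0 ?frob_norm_ge0//.
  exact: ltW.
(* g - B can have large rank, so row blocks are used: 20/9 is twice 10/9, the upper isometry
   constant. *)
have PhiB : frob_norm (sense Z B - y) ^+ 2 <= 20 / 9 * ka * g2.
  rewrite -senseB.
  have rip2 (A : 'M[R]_(m, n)) : (\rank A <= r)%N ->
      frob_norm (sense Z A) ^+ 2 <= 10 / 9 * frob_norm A ^+ 2.
    move=> rA; have /andP[_] := ripc (leq_trans rA (leq_pmull r (isT : (0 < 2)%N))).
    move=> /le_trans; apply; apply: ler_wpM2r; [exact: sqr_ge0|move: c_le; lra].
  have c0 : 0 <= 10 / 9 :> R by lra.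
  have := sense_full_rank r0 (B - g) rm c0 rip2.
  move=> /le_trans; apply; rewrite frob_norm_distC -kaE.
  have ka0 : 0 <= 20 / 9 * ka by lra.
  by have := ler_wpM2l ka0 gB2; lra.
(* The requirement on [t], with factor 1 / ln 2, says that 2^t is at least |y|^2 / ((ka + 2) g2). *)
have yt : frob_norm y ^+ 2 / 2 ^+ t <= (ka + 2) * g2.
  have ge0 : 0 <= (ka + 2) * g2 by apply: mulr_ge0 => //; lra.
  have [y0|y0] := eqVneq y 0; first by rewrite y0 frob_norm0 expr0n mul0r.
  have gn0 : g != 0.
    by apply/eqP => g0; move/eqP: y0; apply; rewrite /y g0 sense0.
  have := ok gn0 y0; rewrite mul1r -kaE -mulrA -g2E.
  have ng : 0 < frob_norm g by rewrite frob_norm_gt0.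
  have ny : 0 < frob_norm y by rewrite frob_norm_gt0.
  have T0 : 0 < (ka + 2) * g2 by rewrite g2E !mulr_gt0 ?exprn_gt0//; lra.
  have ln2 : 0 < ln (2 : R) by rewrite ln_gt0// ltr1n.
  rewrite ler_pdivrMl// => h.
  have : frob_norm y ^+ 2 / ((ka + 2) * g2) <= 2 ^+ t.
    rewrite -ler_ln ?posrE ?divr_gt0 ?exprn_gt0// lnXn// -[_ *+ t]mulr_natr.
    exact: h.
  by rewrite !ler_pdivrMr ?exprn_gt0// mulrC.
have := low_rank_coercive y rH rB.
have : frob_norm (g - G) ^+ 2 <= 2 * frob_norm (G - B) ^+ 2 + 2 * frob_norm (g - B) ^+ 2.
  have -> : g - G = (g - B) - (G - B) by rewrite opprB addrA subrK.
  by have := frob_normB_sqr_le (g - B) (G - B); lra.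
(* The estimates add up to 9/2 (ka + 2 + 80/9 ka) + 2 = 89/2 ka + 11 times [g2], at most 80 ka + 5
   times [g2] since ka >= 1. *)
have -> : delta ^+ 2 * C_IHT 10 m r * frob_norm g ^+ 2 = (80 * ka + 5) * g2.
  by rewrite /C_IHT g2E -kaE; ring.
have : g2 <= ka * g2 by rewrite ler_peMl.
lra.
Qed.

End HardThresholding.

(** Each step lowers [f] by at least a fixed multiple of the squared gradient norm; the sum
    telescopes and the minimum is at most the average. The default value of the minimum is its term
    at k = 0, which is present as K > 0. *)
Lemma iht_descent_rate (R : realType) (m n r d K : nat) (delta L flow : R)
    (f : 'M[R]_(m, n) -> R) (X0 : 'M[R]_(m, n)) (Z : 'I_d -> 'M[R]_(m, n))
    (X : nat -> 'M[R]_(m, n)) :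
  (0 < r)%N -> (r <= m)%N -> 0 < delta ->
  (forall Y, differentiable f Y) -> (forall Y, flow <= f Y) ->
  0 < L -> smooth L f -> (forall Y, approx_low_rank delta r (grad f Y)) ->
  C_IHT 10 m r < delta ^- 2 -> (0 < K)%N ->
  rip_bounds Z (2 * r) 9^-1 ->
  iht_descent f L delta 1 (ln 2)^-1 r K X0 Z X ->
  \big[Num.min/frob_norm (grad f (X 0%N)) ^+ 2]_(k < K) frob_norm (grad f (X k)) ^+ 2
    <= 2 * L * (f X0 - flow) / ((1 - delta ^+ 2 * C_IHT 10 m r) * K%:R).
Proof.
move=> r0 rm d0 df flowP L0 smoothf lowr dC K0 rip [XE Xstep].
have c_ge0 := rip_const_ge0 rip; have c_le := rip_const_le rip.
pose N k := frob_norm (grad f (X k)) ^+ 2.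
pose q := 1 - delta ^+ 2 * C_IHT 10 m r.
have q0 : 0 < q by rewrite subr_gt0 mulrC -ltr_pdivlMr ?exprn_gt0// div1r.
have step k : (k < K)%N -> q * N k <= 2 * L * (f (X k) - f (X k.+1)).
  move=> kK; have [t [G [ok out ->]]] := Xstep k kK.
  have err := iht_gradient_error c_ge0 c_le (rip_constP rip) r0 rm d0 (lowr _) ok out.
  have dec := gradient_step_decrease df smoothf (X k) G L0.
  have h : frob_norm (grad f (X k) - G) ^+ 2 / (2 * L) <= (1 - q) * N k / (2 * L).
    by rewrite ler_pM2r ?invr_gt0 ?mulr_gt0// /q subKr.
  have L2 : 0 < 2 * L by lra.
  rewrite -ler_pdivrMl//.
  move: dec h; rewrite -/(N k); set a := f _; set b := f _ => dec h.
  have -> : (2 * L)^-1 * (q * N k) = N k / (2 * L) - (1 - q) * N k / (2 * L) by ring.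
  lra.
have total j : (j <= K)%N -> q * \sum_(k < j) N k <= 2 * L * (f X0 - f (X j)).
  elim: j => [|j IH] jK; first by rewrite big_ord0 mulr0 XE subrr mulr0.
  rewrite big_ord_recr mulrDr.
  have := IH (ltnW jK); have := step j jK; lra.
rewrite ler_pdivlMr ?mulr_gt0 ?ltr0n// -/q mulrCA.
apply: (@le_trans _ _ (q * \sum_(k < K) N k)).
  rewrite ler_pM2l// mulrC -[K in K%:R]card_ord -sum1_card natr_sum mulr_suml.
  apply: ler_sum => k _; rewrite mul1r; exact: bigmin_le.
apply: (le_trans (total K (leqnn K))).
by rewrite ler_pM2l ?mulr_gt0// lerD2l lerN2.
Qed.

Theorem theorem2 (R : realType) :
  exists (c0 : nat) (c1 C Ct Dt : R),
    [/\ (0 < c0)%N, 0 < c1, 0 < C, 0 < Ct & 0 < Dt] /\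
    forall (m n r d K : nat) (delta L flow : R) (f : 'M[R]_(m, n) -> R)
      (X0 : 'M[R]_(m, n))
      (dT : measure_display) (T : measurableType dT) (P : probability T R)
      (Z : 'I_d -> 'I_m -> 'I_n -> {RV P >-> R})
      (X : T -> nat -> 'M[R]_(m, n)),
      (1 <= r)%N -> (r <= m)%N -> (m <= n)%N ->
      0 < delta -> delta < 1 ->
      (forall Y, differentiable f Y) ->
      (forall Y, flow <= f Y) ->
      0 < L -> smooth L f ->
      (forall Y, approx_low_rank delta r (grad f Y)) ->
      C_IHT C m r < delta ^- 2 ->
      d = (2 * c0 * r * (m + n))%N ->
      iid_gaussian_entries Z ->
      (1 <= K)%N ->
      (forall w, rip_bounds (random_sensing Z w) (2 * r) !=set0 ->
         iht_descent f L delta Ct Dt r K X0 (random_sensing Z w) (X w)) ->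
      exists E : set T,
        [/\ measurable E,
            ((1 - expR (- (c1 * d%:R)))%:E <= P E)%E
          & forall w, E w ->
              \big[Num.min/frob_norm (grad f (X w 0%N)) ^+ 2]_(k < K)
                  frob_norm (grad f (X w k)) ^+ 2
                <= 2 * L * (f X0 - flow) / ((1 - delta ^+ 2 * C_IHT C m r) * K%:R)].
Proof.
have [c0 [c1 [c0_gt0 c1_gt0 rip]]] := gaussian_rip R.
(* [c0] and [c1] come from restricted isometry, 10 from the error budget of [iht_gradient_error],
   and 1 / ln 2 from the halving of the residual. *)
exists c0, c1, 10, 1, (ln 2)^-1; split; first by split; rewrite ?invr_gt0 ?ln_gt0 ?ltr1n.
move=> m n r d K delta L flow f X0 dT T P Z X r0 rm mn d0 d1 df flowP L0 smoothf.
move=> lowr dC dE gaussZ K0 descent.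
have N0 : (0 < 2 * r * (m + n))%N by rewrite !muln_gt0 r0 addn_gt0 (leq_trans r0 rm).
have dE' : d = (c0 * (2 * r * (m + n)))%N by rewrite dE (mulnC 2%N) -!mulnA.
have [E [mE PE Erip]] := rip _ _ _ _ _ _ _ _ N0 dE' gaussZ.
(* On [E] the value 1/9 is an isometry bound for rank 2 r, so [descent] applies to every such
   outcome. *)
exists E; split=> // w /Erip ripw.
exact: (iht_descent_rate r0 rm d0 df flowP L0 smoothf lowr dC K0 ripw
  (descent w (ex_intro _ 9^-1 ripw))).
Qed.
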